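(* Let $E$ be a Banach space, $1<p<\infty$ and $\gamma_p=(1-\frac1p)^{\frac1p-1}$. For $f\in\mathrm{FVL}[E]$ let $$\rho_{p,\infty}(f)=\sup\Big\{\|(f(x_1^* ),\dots,f(x_n^* ))\|_{p,\infty}\Big\},$$ the supremum taken over all $n\in\mathbb N$ and $x_1^*,\dots,x_n^*\in B_{E^*}$ with $\sup_{x\in B_E}\|(x_1^*(x),\dots,x_n^*(x))\|_{p,\infty}\le1$. Then $\rho_{\mathcal X^\sigma_{p,\infty}}=\rho_{p,\infty}$ on $\mathrm{FVL}[E]$, and $\rho_{p,\infty}\le\rho_{\mathcal C_{p,\infty}}\le\gamma_p\,\rho_{p,\infty}$ on $\mathrm{FVL}[E]$.
   Context: $\mathrm{FVL}[E]$ is the vector sublattice of $C(B_{E^*})$ ($B_{E^*}$ with weak$^*$ topology) generated by the functions $\delta_x(x^* )=x^*(x)$, $x\in E$; each linear $T:E\to Y$ into an Archimedean vector lattice extends uniquely to a vector lattice homomorphism $\widehat T$ on $\mathrm{FVL}[E]$ with $\widehat T\delta_x=Tx$. For a class $\mathcal C$ of Banach lattices, $\rho_{\mathcal C}(f)=\sup\{\|\widehat Tf\|_Y:Y\in\mathcal C,\ T:E\to Y\text{ linear contraction}\}$. For $a\in\mathbb R^n$, $\|a\|_{p,\infty}=\max\{|A|^{\frac1p-1}\sum_{i\in A}|a_i|:\emptyset\ne A\subseteq\{1,\dots,n\}\}$. $L^{p,\infty}(\mu)$ is weak-$L^p$ with norm $\|h\|=\sup\{\mu(A)^{\frac1p-1}\int_A|h|\,d\mu:0<\mu(A)<\infty\}$.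 $\mathcal X^\sigma_{p,\infty}$ is the class of all $L^{p,\infty}(\mu)$ with $\mu$ $\sigma$-finite, and $\mathcal C_{p,\infty}$ the class of all Banach lattices satisfying an upper $p$-estimate with constant $1$, i.e. $\|\sum_k x_k\|\le(\sum_k\|x_k\|^p)^{1/p}$ for pairwise disjoint $x_1,\dots,x_m$. *)

(* Defs.v *)
From HB Require Import structures.
From mathcomp Require Import all_boot all_order all_algebra.
From mathcomp Require Import all_classical all_reals all_analysis.
Set Implicit Arguments. Unset Strict Implicit. Unset Printing Implicit Defensive.
Import Order.TTheory GRing.Theory Num.Theory.
Import numFieldNormedType.Exports.
Local Open Scope classical_set_scope.
Local Open Scope ring_scope.

(* Every element of FVL[E] (the vector sublattice of C(B_{E^*}) generated by
   the delta_x) is obtained from the delta_x by finitely many applications of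
   +, real scalar multiplication and binary sup (inf x y = -sup(-x,-y)).
   We represent elements of FVL[E] by such expressions. *)
Inductive fvl_expr (R : Type) (V : Type) :=
  | FAtom of V
  | FAdd of fvl_expr R V & fvl_expr R V
  | FScale of R & fvl_expr R V
  | FSup of fvl_expr R V & fvl_expr R V.

(* Generic evaluation of an expression in a vector lattice Y given the value
   of the atoms (this is the unique lattice homomorphism extension). *)
Fixpoint fvl_eval (R : Type) (V Y : Type) (add : Y -> Y -> Y)
  (scale : R -> Y -> Y) (sup : Y -> Y -> Y) (T : V -> Y) (f : fvl_expr R V) : Y :=
  match f with
  | FAtom x => T x
  | FAdd f g => add (fvl_eval add scale sup T f) (fvl_eval add scale sup T g)
  | FScale a f => scale a (fvl_eval add scale sup T f)
  | FSup f g => sup (fvl_eval add scale sup T f) (fvl_eval add scale sup T g)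
  end.

Section Defs.
Variable R : realType.

(* x^* in B_{E^*}: linear functional of norm <= 1 (continuity is automatic). *)
Definition dual_ball (E : normedModType R) (phi : E -> R) : Prop :=
  (forall (a : R) (u v : E), phi (a *: u + v) = a * phi u + phi v) /\
  (forall x : E, `|phi x| <= `|x|).

Definition fvl_at (E : normedModType R) (f : fvl_expr R E) (phi : E -> R) : R :=
  fvl_eval (fun a b => a + b) (fun a b => a * b) Num.max phi f.

Definition wpnorm (p : R) (n : nat) (a : 'I_n -> R) : R :=
  \big[Num.max/0]_(A : {set 'I_n} | A != finset.set0)
     ((#|A|%:R) `^ (p^-1 - 1) * \sum_(i in A) `|a i|).

Definition rho_pinf (p : R) (E : normedModType R) (f : fvl_expr R E) : \bar R :=
  ereal_sup [set r | exists (n : nat) (xs : 'I_n -> E -> R),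
    (forall i, dual_ball (xs i)) /\
    (forall x : E, `|x| <= 1 -> wpnorm p (fun i => xs i x) <= 1) /\
    r = (wpnorm p (fun i => fvl_at f (xs i)))%:E].

Definition bl_abs (Y : normedModType R) (sup : Y -> Y -> Y) (x : Y) := sup x (- x).
Definition bl_inf (Y : normedModType R) (sup : Y -> Y -> Y) (x y : Y) :=
  - sup (- x) (- y).

Definition is_banach_lattice (Y : completeNormedModType R)
  (le : Y -> Y -> Prop) (sup : Y -> Y -> Y) : Prop :=
  (forall x, le x x) /\
  (forall x y, le x y -> le y x -> x = y) /\
  (forall x y z, le x y -> le y z -> le x z) /\
  (forall x y z, le x y -> le (x + z) (y + z)) /\
  (forall (a : R) x, 0 <= a -> le 0 x -> le 0 (a *: x)) /\
  (forall x y, le x (sup x y) /\ le y (sup x y) /\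
               (forall z, le x z -> le y z -> le (sup x y) z)) /\
  (forall x y, le (bl_abs sup x) (bl_abs sup y) -> `|x| <= `|y|).

Definition upper_p_estimate (p : R) (Y : normedModType R) (sup : Y -> Y -> Y) : Prop :=
  forall (m : nat) (x : 'I_m -> Y),
    (forall i j, i != j -> bl_inf sup (bl_abs sup (x i)) (bl_abs sup (x j)) = 0) ->
    `|\sum_(i < m) x i| <= (\sum_(i < m) `|x i| `^ p) `^ p^-1.

Definition is_contraction (E Y : normedModType R) (T : E -> Y) : Prop :=
  (forall (a : R) (u v : E), T (a *: u + v) = a *: T u + T v) /\
  (forall x, `|T x| <= `|x|).

Definition rho_Cpinf (p : R) (E : normedModType R) (f : fvl_expr R E) : \bar R :=
  ereal_sup [set r | exists (Y : completeNormedModType R) (le : Y -> Y -> Prop)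
      (sup : Y -> Y -> Y) (T : E -> Y),
    is_banach_lattice le sup /\ upper_p_estimate p sup /\ is_contraction T /\
    r = (`| fvl_eval (fun a b => a + b) (fun a b => a *: b) sup T f |)%:E].

(* ||h||_{L^{p,infty}(mu)} = sup { mu(A)^{1/p-1} int_A |h| : 0 < mu A < oo };
   the value 0 is added to cover the case where no such A exists. *)
Definition wLnorm (p : R) d (T : measurableType d) (mu : {measure set T -> \bar R})
  (h : T -> R) : \bar R :=
  ereal_sup ([set 0%E] `|` [set r | exists A : set T, measurable A /\
      (0 < mu A)%E /\ (mu A < +oo)%E /\
      r = (((fine (mu A)) `^ (p^-1 - 1))%:E * \int[mu]_(t in A) (`|h t|)%:E)%E]).

(* rho_{X^sigma_{p,infty}}: supremum over sigma-finite mu and linear contractions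
   T : E -> L^{p,infty}(mu); elements of L^{p,infty}(mu) are represented by
   measurable functions, equality being mu-a.e. equality; the lattice
   operations are pointwise. *)
Definition rho_Xpinf (p : R) (E : normedModType R) (f : fvl_expr R E) : \bar R :=
  ereal_sup [set r | exists d (Ω : measurableType d) (mu : {measure set Ω -> \bar R})
      (T : E -> Ω -> R),
    sigma_finite setT mu /\
    (forall x, measurable_fun setT (T x)) /\
    (forall (a : R) (u v : E), {ae mu, forall t, T (a *: u + v) t = a * T u t + T v t}) /\
    (forall x, (wLnorm p mu (T x) <= (`|x|)%:E)%E) /\
    r = wLnorm p mu (fun t => fvl_eval (fun a b => a + b) (fun a b => a * b)
                                  Num.max (fun x => T x t) f)].

Definition gamma_p (p : R) : R := (1 - p^-1) `^ (p^-1 - 1).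

End Defs.

(* Main.v *)
Require Import Defs.
From HB Require Import structures.
From mathcomp Require Import all_boot all_order all_algebra.
From mathcomp Require Import all_classical all_reals all_analysis.
From mathcomp Require Import measurable_realfun.
From mathcomp Require Import ring lra.
Set Implicit Arguments. Unset Strict Implicit. Unset Printing Implicit Defensive.
Import Order.TTheory GRing.Theory Num.Theory.
Import numFieldNormedType.Exports.
Local Open Scope ring_scope.

(** Both upper bounds reduce to finitely many functionals [psi i] on [E] with weights
    [m i] such that [\sum_(i in S) `|psi i x| <= (\sum_(i in S) m i) `^ (1 - 1/p)] on the
    unit ball, for every [S]: approximating the weights by multiples of a small number
    and repeating functionals gives
    [\sum_i `|f (psi i)| <= rho_pinf p f * (\sum_i m i) `^ (1 - 1/p)].
    In [L^{p,oo}(mu)], cut a set [A] of finite measure into cells on which every generator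
    [T x] of [f] is almost a constant multiple of the sum [e] of the absolute values of
    the generators; [psi i] is the integral of [T x] over a cell and [m i] the measure of
    the cell.
    In a Banach lattice with an upper [p]-estimate, let [w] be the normalised absolute
    value of the image of [f] and [phi] a positive functional of norm 1 with [phi w = 1];
    cut [phi] into disjoint band components [F i] on which the generators are almost
    multiples of [e].  For [0 <= z] in the unit ball and [t >= 0] the upper [p]-estimate
    yields [\sum_(i notin S) F i w + t * \sum_(i in S) F i z <= (1 + t `^ p) `^ (1/p)],
    so with [1/p + 1/q = 1] the weights [m i = q * F i w] are admissible, of total mass
    [q], and [q `^ (1/q) = gamma_p p].
    Conversely, functionals [xs i], [i < n], are the coordinates of an operator into
    [R^n] with the weak norm, which is [L^{p,oo}] of a counting measure and has an upper
    [p]-estimate by Hoelder's inequality. *)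

(** * Tangent-line inequalities for concave powers *)

Section real_inequalities.
Variable R : realType.
Implicit Types (th M s : R).

(** Young's inequality with exponents 1/[th] and 1/(1 - [th]), divided by s^(1 - th). *)
Lemma powR_tangent th M s : 0 < th < 1 -> 0 <= M -> 0 < s ->
  M `^ th <= s `^ th + th * s `^ (th - 1) * (M - s).
Proof.
move=> /andP[th0 th1] M0 s0.
have th1' : 0 < 1 - th by rewrite subr_gt0.
have := @conjugate_powR R (M `^ th) (s `^ (1 - th)) th^-1 (1 - th)^-1
  (powR_ge0 _ _) (powR_ge0 _ _).
rewrite !invr_gt0 !invrK => /(_ th0 th1' (subrKC _ _)).
rewrite -!powRrM !mulfV ?gt_eqF// !powRr1// ?(ltW s0)// => young.
have s1 : s `^ (1 - th) * s `^ (th - 1) = 1.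
  have e0 : 1 - th + (th - 1) = 0 by ring.
  by rewrite -powRD e0 ?powRr0// eqxx/= gt_eqF.
have s2 : s * s `^ (th - 1) = s `^ th by rewrite mulr_powRB1// ltW.
have := ler_wpM2r (powR_ge0 s (th - 1)) young.
rewrite -[leLHS]mulrA s1 mulr1 => /le_trans; apply.
rewrite -s2; lra.
Qed.

(* With [lam] the slope of [x `^ th] at [s = \sum_i t i], the left side is at most
   [\sum_(i in S) m i * (a i - lam) + lam * s] for [S = {i | lam < a i}], and the
   hypothesis for [S] together with the tangent line at [s] bounds this by [s `^ th]. *)
Lemma sum_le_powR_sum (I : finType) th (m a t : I -> R) : 0 < th < 1 ->
  (forall i, 0 <= t i <= m i) ->
  (forall S : {set I}, \sum_(i in S) m i * a i <= (\sum_(i in S) m i) `^ th) ->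
  \sum_i t i * a i <= (\sum_i t i) `^ th.
Proof.
move=> th01 tm H.
have t0 i : 0 <= t i by case/andP: (tm i).
have m0 i : 0 <= m i by case/andP: (tm i) => /le_trans; apply.
have : 0 <= \sum_i t i by apply: sumr_ge0.
rewrite le_eqVlt => /predU1P[|s0].
  move=> /esym/eqP; rewrite psumr_eq0// => /allP ts.
  rewrite big1 ?powR_ge0// => i _.
  by have /(_ (mem_index_enum _))/eqP -> := ts i; rewrite mul0r.
set s := \sum_i t i in s0 *; set lam := th * s `^ (th - 1).
pose S := [set i | lam < a i]%SET.
have -> : \sum_i t i * a i = \sum_i t i * (a i - lam) + lam * s.
  by rewrite mulr_sumr -big_split/=; apply: eq_bigr => i _; ring.
have le1 : \sum_i t i * (a i - lam) <= \sum_(i in S) m i * (a i - lam).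
  rewrite [leRHS]big_mkcond/=; apply: ler_sum => i _; rewrite inE.
  case: ltP => ai; last by rewrite mulr_ge0_le0// subr_le0.
  by apply: ler_wpM2r; [rewrite subr_ge0 ltW|case/andP: (tm i)].
apply: le_trans (lerD le1 (lexx _)) _.
have -> : \sum_(i in S) m i * (a i - lam) =
    \sum_(i in S) m i * a i - lam * \sum_(i in S) m i.
  by rewrite mulr_sumr -sumrB; apply: eq_bigr => i _; ring.
have mS0 : 0 <= \sum_(i in S) m i by apply: sumr_ge0.
have := powR_tangent th01 mS0 s0.
move: (H S); rewrite -/lam; set x := \sum_(i in S) m i * a i.
set y := \sum_(i in S) m i; lra.
Qed.

End real_inequalities.

(** * The Hahn-Banach theorem by minimal sublinear functionals *)

Section hahn_banach.
Variables (R : realType) (V : lmodType R).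
Implicit Types (q : V -> R) (x y w : V).

Definition sublinear q :=
  (forall x y, q (x + y) <= q x + q y) /\
  (forall a x, 0 <= a -> q (a *: x) = a * q x).

Lemma sublinear0 q : sublinear q -> q 0 = 0.
Proof. by case=> _ /(_ 0 0 (lexx _)); rewrite scale0r mul0r. Qed.

Lemma sublinear_lb q x : sublinear q -> - q (- x) <= q x.
Proof.
move=> sq; rewrite lerNl -subr_ge0 opprK -(sublinear0 sq) -(addNr x).
exact: sq.1.
Qed.

(** The scaling inequality applied to [a^-1] yields its own converse. *)
Lemma sublinear_intro q : (forall x y, q (x + y) <= q x + q y) -> q 0 = 0 ->
  (forall a x, 0 < a -> q (a *: x) <= a * q x) -> sublinear q.
Proof.
move=> qD q0 qZ; split=> // a x; rewrite le_eqVlt => /predU1P[<-|a0].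
  by rewrite scale0r mul0r.
apply/le_anti; rewrite qZ//= -ler_pdivlMl//.
by rewrite (le_trans _ (qZ _ _ _)) ?invr_gt0// scalerA mulVf ?gt_eqF// scale1r.
Qed.

(* The infimum of [q (x + t *: y) - t * q y] over [t >= 0] is sublinear, and at
   [- y] its value is at most the one for [t = 1]. *)
Lemma sublinear_decrease q y : sublinear q ->
  exists q', [/\ sublinear q', forall x, q' x <= q x & q' (- y) <= - q y].
Proof.
move=> sq.
pose A x := [set q (x + t *: y) - t * q y | t in [set t | 0 <= t]]%classic.
have lbA x : lbound (A x) (- q (- x)).
  move=> _ [t /= t0 <-]; rewrite lerBrDr -sq.2// addrC lerBlDr.
  by rewrite (le_trans _ (sq.1 _ _))// [x + _]addrC addrK.
have hlA x : has_lbound (A x) by exists (- q (- x)).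
have neA x : (A x !=set0)%classic.
  by exists (q (x + 0 *: y) - 0 * q y); exists 0 => //=.
have infA x t : 0 <= t -> inf (A x) <= q (x + t *: y) - t * q y.
  by move=> t0; apply: ge_inf => //; exists t.
exists (fun x => inf (A x)); split.
- apply: sublinear_intro.
  + move=> x x'.
    suff H : lbound (A x') (inf (A (x + x')) - inf (A x)).
      by rewrite -lerBlDl; exact: lb_le_inf.
    move=> _ [t' /= t'0 <-]; rewrite lerBlDr -lerBlDl.
    apply: lb_le_inf => // _ [t /= t0 <-].
    rewrite lerBlDl (le_trans (infA _ (t + t') _)) ?addr_ge0//.
    rewrite scalerDl addrACA.
    have := sq.1 (x + t *: y) (x' + t' *: y); lra.
  + apply/le_anti; apply/andP; split.
      by have := infA 0 0 (lexx _); rewrite scale0r mul0r subr0 addr0 sublinear0.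
    by apply: lb_le_inf => // _ [t /= t0 <-]; rewrite add0r sq.2// subrr.
  + move=> a x a0; rewrite -ler_pdivrMl//; apply: lb_le_inf => // _ [t /= t0 <-].
    rewrite ler_pdivrMl// (le_trans (infA _ (a * t) _)) ?mulr_ge0 ?(ltW a0)//.
    by rewrite -scalerA -scalerDr sq.2 ?(ltW a0)// mulrBr mulrA.
- by move=> x; rewrite (le_trans (infA x 0 (lexx _)))// scale0r mul0r subr0 addr0.
- by rewrite (le_trans (infA _ 1 ler01))// scale1r addNr sublinear0// mul1r add0r.
Qed.

(** Zorn's lemma: a chain has its pointwise infimum as lower bound, finite because each member is at
    least - p (- x) at x. *)
Lemma minimal_sublinear p : sublinear p ->
  exists q, [/\ sublinear q, forall x, q x <= p x &
    forall q', sublinear q' -> (forall x, q' x <= q x) -> forall x, q x <= q' x].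
Proof.
move=> sp; pose P q := sublinear q /\ forall x, q x <= p x.
(* The pointwise order is reversed: maximal elements for [le] are minimal functionals. *)
pose T := {q | P q}; pose le (q q' : T) := `[< forall x, sval q' x <= sval q x >].
have Pp : P p by split.
have [|||[q [sq qp]] qmin] := @ZL_preorder T (exist _ p Pp) le.
- by move=> t; apply/asboolP => x.
- by move=> r s t /asboolP rs /asboolP st; apply/asboolP => x; exact: le_trans (rs x).
- move=> A totA.
  have [[q0 Aq0]|A0] := pselect (exists q : T, A q); last first.
    by exists (exist _ p Pp) => s As; exfalso; apply: A0; exists s.
  pose B x := [set sval q x | q in A]%classic.
  have lbB x : lbound (B x) (- p (- x)).
    move=> _ [[q [sq qp]] /= Aq <-].
    by rewrite (le_trans _ (sublinear_lb _ sq))// lerN2.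
  have hlB x : has_lbound (B x) by exists (- p (- x)).
  have neB x : (B x !=set0)%classic by exists (sval q0 x); exists q0.
  have infB x (q : T) : A q -> inf (B x) <= sval q x.
    by move=> Aq; apply: ge_inf => //; exists q.
  have PB : P (fun x => inf (B x)).
    split; last by move=> x; rewrite (le_trans (infB _ q0 _))//; case: (svalP q0).
    apply: sublinear_intro.
    + move=> x x'.
      rewrite -lerBlDl; apply: lb_le_inf => // _ [q' /= Aq' <-].
      rewrite lerBlDr -lerBlDl; apply: lb_le_inf => // _ [q /= Aq <-].
      rewrite lerBlDl addrC.
      (* The smaller of [q] and [q'] is below both, so its subadditivity suffices. *)
      have [/asboolP qq'|/asboolP qq'] := totA _ _ Aq Aq'.
        apply: le_trans (infB _ q' Aq') _; apply: le_trans ((svalP q').1.1 _ _) _.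
        by apply: lerD => //; exact: qq'.
      apply: le_trans (infB _ q Aq) _; apply: le_trans ((svalP q).1.1 _ _) _.
      by apply: lerD => //; exact: qq'.
    + apply/le_anti; apply/andP; split.
        by rewrite (le_trans (infB _ q0 _))// (sublinear0 (svalP q0).1).
      by apply: lb_le_inf => // _ [q /= Aq <-]; rewrite (sublinear0 (svalP q).1).
    + move=> a x a0; rewrite -ler_pdivrMl//; apply: lb_le_inf => // _ [q /= Aq <-].
      by rewrite ler_pdivrMl// -(svalP q).1.2 ?(ltW a0)// infB.
  exists (exist _ _ PB) => q Aq; apply/asboolP => x /=; exact: infB.
- exists q; split=> // q' sq' q'q x.
  have Pq' : P q' by split=> // y; rewrite (le_trans (q'q y)).
  by have /asboolP := qmin (exist _ q' Pq') (asboolT q'q); apply.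
Qed.

(** A minimal sublinear functional is linear: [sublinear_decrease] cannot lower it, whence phi (- x)
    <= - phi x. Decreasing [p] in the direction [w] before minimising forces phi w = p w. *)
Lemma hahn_banach p w : sublinear p -> exists phi : V -> R,
  [/\ forall a x y, phi (a *: x + y) = a * phi x + phi y,
      forall x, phi x <= p x & phi w = p w].
Proof.
move=> sp; have [p' [sp' p'p p'w]] := sublinear_decrease w sp.
have [phi [sphi phip' phimin]] := minimal_sublinear sp'.
have phiN x : phi (- x) = - phi x.
  have [q [sq qphi qx]] := sublinear_decrease x sphi.
  apply/le_anti; rewrite (le_trans (phimin _ sq qphi _) qx)/=.
  by rewrite -{1}[x]opprK sublinear_lb.
have phiD x y : phi (x + y) = phi x + phi y.
  apply/le_anti; rewrite sphi.1/= -lerBrDr -phiN.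
  by rewrite (le_trans _ (sphi.1 _ _))// addrK.
exists phi; split.
- move=> a x y; rewrite phiD; congr (_ + _).
  have [a0|a0] := leP 0 a; first by rewrite sphi.2.
  by rewrite -[a]opprK scaleNr -scalerN sphi.2 ?phiN ?mulrN ?mulNr// oppr_ge0 ltW.
- by move=> x; rewrite (le_trans (phip' x)).
- apply/le_anti; rewrite (le_trans (phip' _) (p'p _))/=.
  by rewrite -lerN2 -phiN (le_trans (phip' _)).
Qed.

End hahn_banach.

(** * Order and norm calculus in a Banach lattice *)

Section banach_lattice.
Variables (R : realType) (Y : completeNormedModType R).
Variables (le : Y -> Y -> Prop) (sup : Y -> Y -> Y).
Hypothesis BL : is_banach_lattice le sup.
Implicit Types (x y z u v : Y) (a t : R).

Local Notation "x <<= y" := (le x y) (at level 70, no associativity).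
Local Notation abs := (bl_abs sup).
Local Notation inf := (bl_inf sup).

Definition bl_pos x := sup x 0.
Local Notation pos := bl_pos.

Lemma bl_lexx x : x <<= x.
Proof. by case: BL. Qed.

Lemma bl_anti x y : x <<= y -> y <<= x -> x = y.
Proof. by case: BL => _ [H _]; exact: H. Qed.

Lemma bl_trans x y z : x <<= y -> y <<= z -> x <<= z.
Proof. by case: BL => _ [_ [H _]]; exact: H. Qed.

Lemma bl_leD2r x y z : x <<= y -> x + z <<= y + z.
Proof. by case: BL => _ [_ [_ [H _]]]; exact: H. Qed.

Lemma bl_ge0Z a x : 0 <= a -> 0 <<= x -> 0 <<= a *: x.
Proof. by case: BL => _ [_ [_ [_ [H _]]]]; exact: H. Qed.

Lemma bl_supl x y : x <<= sup x y.
Proof. by case: BL => _ [_ [_ [_ [_ [H _]]]]]; case: (H x y). Qed.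

Lemma bl_supr x y : y <<= sup x y.
Proof. by case: BL => _ [_ [_ [_ [_ [H _]]]]]; case: (H x y) => _ []. Qed.

Lemma bl_sup_le x y z : x <<= z -> y <<= z -> sup x y <<= z.
Proof. by case: BL => _ [_ [_ [_ [_ [H _]]]]]; case: (H x y) => _ []; auto. Qed.

Lemma bl_norm_le_abs x y : abs x <<= abs y -> `|x| <= `|y|.
Proof. by case: BL => _ [_ [_ [_ [_ [_ H]]]]]; exact: H. Qed.

Lemma bl_leD x y z u : x <<= y -> z <<= u -> x + z <<= y + u.
Proof.
move=> xy zu; apply: bl_trans (bl_leD2r z xy) _.
by rewrite ![y + _]addrC; exact: bl_leD2r.
Qed.

Lemma bl_ge0D x y : 0 <<= x -> 0 <<= y -> 0 <<= x + y.
Proof. by move=> x0 y0; rewrite -[0]addr0; exact: bl_leD. Qed.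

Lemma bl_subge0 x y : (0 <<= y - x) <-> (x <<= y).
Proof.
split=> [/(bl_leD2r x)|/(bl_leD2r (- x))]; first by rewrite add0r subrK.
by rewrite subrr.
Qed.

Lemma bl_leN x y : x <<= y -> - y <<= - x.
Proof. by move=> /bl_subge0 H; apply/bl_subge0; rewrite opprK addrC. Qed.

Lemma bl_leNr x y : x <<= - y -> y <<= - x.
Proof. by move=> /bl_leN; rewrite opprK. Qed.

Lemma bl_leZ a x y : 0 <= a -> x <<= y -> a *: x <<= a *: y.
Proof.
move=> a0 /bl_subge0 xy; apply/bl_subge0; rewrite -scalerBr; exact: bl_ge0Z.
Qed.

Lemma bl_ge0_sum (I : finType) (P : pred I) (F : I -> Y) :
  (forall i, P i -> 0 <<= F i) -> 0 <<= \sum_(i | P i) F i.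
Proof. by move=> F0; elim/big_ind : _ => //; [exact: bl_lexx|exact: bl_ge0D]. Qed.

Lemma bl_le_sup x y x' y' : x <<= x' -> y <<= y' -> sup x y <<= sup x' y'.
Proof.
move=> xx' yy'; apply: bl_sup_le.
  exact: bl_trans xx' (bl_supl _ _).
exact: bl_trans yy' (bl_supr _ _).
Qed.

Lemma bl_supD x y z : sup (x + z) (y + z) = sup x y + z.
Proof.
apply: bl_anti.
  by apply: bl_sup_le; apply: bl_leD2r; [exact: bl_supl|exact: bl_supr].
rewrite -[X in _ <<= X](subrK z); apply: bl_leD2r; apply: bl_sup_le.
  by rewrite -{1}[x](addrK z); apply: bl_leD2r; exact: bl_supl.
by rewrite -{1}[y](addrK z); apply: bl_leD2r; exact: bl_supr.
Qed.

Lemma bl_supZ a x y : 0 <= a -> sup (a *: x) (a *: y) = a *: sup x y.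
Proof.
rewrite le_eqVlt => /predU1P[<-|a0].
  rewrite !scale0r; apply: bl_anti; last exact: bl_supl.
  by apply: bl_sup_le; exact: bl_lexx.
have a1 : 0 <= a^-1 by rewrite invr_ge0 ltW.
have aK z : a *: (a^-1 *: z) = z by rewrite scalerA mulfV ?gt_eqF// scale1r.
have Ka z : a^-1 *: (a *: z) = z by rewrite scalerA mulVf ?gt_eqF// scale1r.
apply: bl_anti.
  by apply: bl_sup_le; apply: bl_leZ; rewrite ?ltW//; [exact: bl_supl|exact: bl_supr].
rewrite -[X in _ <<= X]aK; apply: bl_leZ; first exact: ltW.
apply: bl_sup_le.
  by rewrite -{1}[x]Ka; apply: bl_leZ => //; exact: bl_supl.
by rewrite -{1}[y]Ka; apply: bl_leZ => //; exact: bl_supr.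
Qed.

Lemma bl_supC x y : sup x y = sup y x.
Proof.
by apply: bl_anti; apply: bl_sup_le; (exact: bl_supl) || (exact: bl_supr).
Qed.

Lemma bl_sup_max a b y : 0 <<= y -> sup (a *: y) (b *: y) = Num.max a b *: y.
Proof.
wlog ab : a b / a <= b.
  move=> H y0; have [ab|/ltW ab] := leP a b; first by rewrite H// max_r.
  by rewrite bl_supC H// max_r.
move=> y0; rewrite max_r//; apply: bl_anti; last exact: bl_supr.
apply: bl_sup_le; last exact: bl_lexx.
by apply/bl_subge0; rewrite -scalerBl; apply: bl_ge0Z; rewrite ?subr_ge0.
Qed.

Lemma bl_pos_ge0 x : 0 <<= pos x.
Proof. exact: bl_supr. Qed.

Lemma bl_le_pos x : x <<= pos x.
Proof. exact: bl_supl. Qed.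

Lemma bl_pos_le x y : x <<= y -> 0 <<= y -> pos x <<= y.
Proof. exact: bl_sup_le. Qed.

Lemma bl_pos_id x : 0 <<= x -> pos x = x.
Proof.
move=> x0; apply: bl_anti; last exact: bl_le_pos.
by apply: bl_pos_le => //; exact: bl_lexx.
Qed.

Lemma bl_pos_le0 x : 0 <<= x -> pos (- x) = 0.
Proof.
move=> /bl_leN; rewrite oppr0 => x0; apply: bl_anti; last exact: bl_pos_ge0.
by apply: bl_pos_le => //; exact: bl_lexx.
Qed.

Lemma bl_posD x y : pos (x + y) <<= pos x + pos y.
Proof.
apply: bl_pos_le; first by apply: bl_leD; exact: bl_le_pos.
by apply: bl_ge0D; exact: bl_pos_ge0.
Qed.

Lemma bl_posZ a x : 0 <= a -> pos (a *: x) = a *: pos x.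
Proof. by move=> a0; rewrite /pos -bl_supZ// scaler0. Qed.

Lemma bl_posBneg x : pos x - pos (- x) = x.
Proof.
have {1}-> : pos x = pos (- x) + x by rewrite /pos -bl_supD addNr add0r bl_supC.
by rewrite addrAC subrr add0r.
Qed.

Lemma bl_absE x : abs x = pos x + pos (- x).
Proof.
have -> : abs x = pos (2%:R *: x) - x.
  by rewrite /pos -bl_supD add0r scaler_nat mulr2n addrK.
by rewrite bl_posZ// -{2}(bl_posBneg x) opprB addrA addrAC scaler_nat mulr2n addrK.
Qed.

Lemma bl_abs_ge0 x : 0 <<= abs x.
Proof. by rewrite bl_absE; apply: bl_ge0D; exact: bl_pos_ge0. Qed.

Lemma bl_le_abs x : x <<= abs x.
Proof. exact: bl_supl. Qed.

Lemma bl_leN_abs x : - x <<= abs x.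
Proof. exact: bl_supr. Qed.

Lemma bl_abs_le x y : x <<= y -> - x <<= y -> abs x <<= y.
Proof. exact: bl_sup_le. Qed.

Lemma bl_abs_id x : 0 <<= x -> abs x = x.
Proof. by move=> x0; rewrite bl_absE bl_pos_id// bl_pos_le0// addr0. Qed.

Lemma bl_absN x : abs (- x) = abs x.
Proof. by rewrite !bl_absE opprK addrC. Qed.

Lemma bl_absD x y : abs (x + y) <<= abs x + abs y.
Proof.
apply: bl_abs_le; first by apply: bl_leD; exact: bl_le_abs.
by rewrite opprD; apply: bl_leD; exact: bl_leN_abs.
Qed.

Lemma bl_absZ a x : abs (a *: x) = `|a| *: abs x.
Proof.
wlog a0 : a / 0 <= a.
  move=> H; have [a0|/ltW a0] := leP 0 a; first exact: H.
  by rewrite -[a]opprK scaleNr bl_absN H ?oppr_ge0// !normrN.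
by rewrite /bl_abs ger0_norm// -scalerN bl_supZ.
Qed.

Lemma bl_sup_sub x1 y1 x2 y2 :
  sup x1 y1 - sup x2 y2 <<= abs (x1 - x2) + abs (y1 - y2).
Proof.
rewrite -[X in _ <<= X](addrK (sup x2 y2)); apply: bl_leD2r; apply: bl_sup_le.
  rewrite -{1}[x1](subrK x2); apply: bl_leD; last exact: bl_supl.
  rewrite -{1}[x1 - x2]addr0; apply: bl_leD; [exact: bl_le_abs|exact: bl_abs_ge0].
rewrite -{1}[y1](subrK y2); apply: bl_leD; last exact: bl_supr.
rewrite -{1}[y1 - y2]add0r; apply: bl_leD; [exact: bl_abs_ge0|exact: bl_le_abs].
Qed.

(** This Lipschitz property carries approximations of the generators through [FSup]. *)
Lemma bl_abs_sup x y x' y' :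
  abs (sup x y - sup x' y') <<= abs (x - x') + abs (y - y').
Proof.
apply: bl_abs_le; first exact: bl_sup_sub.
by rewrite opprB -(bl_absN (x - x')) -(bl_absN (y - y')) !opprB; exact: bl_sup_sub.
Qed.

Lemma bl_norm_abs x : `|abs x| = `|x|.
Proof.
have H : abs (abs x) = abs x by rewrite bl_abs_id//; exact: bl_abs_ge0.
by apply/le_anti; rewrite !bl_norm_le_abs//; rewrite H; exact: bl_lexx.
Qed.

Lemma bl_norm_le x y : 0 <<= x -> x <<= y -> `|x| <= `|y|.
Proof.
move=> x0 xy; apply: bl_norm_le_abs; rewrite !bl_abs_id//.
exact: bl_trans xy.
Qed.

Lemma bl_infE x y : inf x y = x - pos (x - y).
Proof.
rewrite /bl_inf; have -> : sup (- x) (- y) = pos (x - y) - x.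
  by rewrite /pos -bl_supD add0r addrAC subrr add0r bl_supC.
by rewrite opprB.
Qed.

Lemma bl_infl x y : inf x y <<= x.
Proof. by rewrite -[X in _ <<= X]opprK; apply: bl_leN; exact: bl_supl. Qed.

Lemma bl_infr x y : inf x y <<= y.
Proof. by rewrite -[X in _ <<= X]opprK; apply: bl_leN; exact: bl_supr. Qed.

Lemma bl_le_inf x y z : z <<= x -> z <<= y -> z <<= inf x y.
Proof. by move=> zx zy; apply: bl_leNr; apply: bl_sup_le; exact: bl_leN. Qed.

Lemma bl_inf_id x y : x <<= y -> inf x y = x.
Proof.
by move=> xy; apply: bl_anti; [exact: bl_infl|apply: bl_le_inf => //; exact: bl_lexx].
Qed.

Lemma bl_pos_disjoint x : inf (pos x) (pos (- x)) = 0.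
Proof. by rewrite bl_infE bl_posBneg subrr. Qed.

(** With a the left side, a = inf a x + pos (a - x); the first part lies below x and v, the second
    below y and v because a <= x + y. *)
Lemma bl_infDl x y v : 0 <<= x -> 0 <<= y -> 0 <<= v ->
  inf (x + y) v <<= inf x v + inf y v.
Proof.
move=> x0 y0 v0; set a := inf (x + y) v.
have av : a <<= v by exact: bl_infr.
have a0 : 0 <<= a by apply: bl_le_inf => //; exact: bl_ge0D.
have -> : a = inf a x + pos (a - x) by rewrite bl_infE subrK.
apply: bl_leD.
  by apply: bl_le_inf; [exact: bl_infr|apply: bl_trans av; exact: bl_infl].
apply: bl_le_inf.
  apply: bl_pos_le => //; apply/bl_subge0; rewrite opprB addrA [y + x]addrC.
  by apply/bl_subge0; exact: bl_infl.
apply: bl_trans av; apply: bl_pos_le => //.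
by apply/bl_subge0; rewrite opprB addrC subrK.
Qed.

Lemma bl_infD x y u v : inf x u + inf y v <<= inf (x + y) (u + v).
Proof.
apply: bl_le_inf; apply: bl_leD;
  (exact: bl_infl) || (exact: bl_infr).
Qed.

End banach_lattice.

(** * Positive functionals and their band components *)

Section positive_functionals.
Variables (R : realType) (Y : completeNormedModType R).
Variables (le : Y -> Y -> Prop) (sup : Y -> Y -> Y).
Hypothesis BL : is_banach_lattice le sup.
Implicit Types (x y z u v : Y) (a t : R) (phi psi : Y -> R).

Local Notation "x <<= y" := (le x y) (at level 70, no associativity).
Local Notation abs := (bl_abs sup).
Local Notation inf := (bl_inf sup).
Local Notation pos := (bl_pos sup).
Let pos_ge0 := bl_pos_ge0 BL.

Definition posfun phi :=
  (forall a x y, phi (a *: x + y) = a * phi x + phi y) /\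
  (forall x, 0 <<= x -> 0 <= phi x).

Section posfun_theory.
Variables (phi : Y -> R) (phip : posfun phi).

Lemma posfunD x y : phi (x + y) = phi x + phi y.
Proof. by have := phip.1 1 x y; rewrite scale1r mul1r. Qed.

Lemma posfun0 : phi 0 = 0.
Proof. by have := posfunD 0 0; rewrite addr0 => /eqP; rewrite addrC -subr_eq subrr => /eqP. Qed.

Lemma posfunZ a x : phi (a *: x) = a * phi x.
Proof. by have := phip.1 a x 0; rewrite posfun0 !addr0. Qed.

Lemma posfunN x : phi (- x) = - phi x.
Proof. by rewrite -scaleN1r posfunZ mulN1r. Qed.

Lemma posfunB x y : phi (x - y) = phi x - phi y.
Proof. by rewrite posfunD posfunN. Qed.

Lemma posfun_le x y : x <<= y -> phi x <= phi y.
Proof. by move=> /(bl_subge0 BL)/(phip.2); rewrite posfunB subr_ge0. Qed.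

Lemma posfun_abs x : `|phi x| <= phi (abs x).
Proof.
rewrite ler_norml lerNl -posfunN; apply/andP.
by split; apply: posfun_le; [exact: (bl_leN_abs BL)|exact: (bl_le_abs BL)].
Qed.

End posfun_theory.

Lemma posfun_bigsum (I : finType) (P : pred I) (F : I -> Y -> R) :
  (forall i, posfun (F i)) -> posfun (fun x => \sum_(i | P i) F i x).
Proof.
move=> Fp; split=> [a x y|x x0]; last by apply: sumr_ge0 => i _; exact: (Fp i).2.
by rewrite mulr_sumr -big_split/=; apply: eq_bigr => i _; rewrite (Fp i).1.
Qed.

(** The extension is g (pos x) - g (pos (- x)). It is additive because g is additive on both sides
    of (x+y)^+ + x^- + y^- = (x+y)^- + x^+ + y^+, where every term is positive. *)
Lemma posfun_extend (g : Y -> R) :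
  (forall x y, 0 <<= x -> 0 <<= y -> g (x + y) = g x + g y) ->
  (forall a x, 0 <= a -> 0 <<= x -> g (a *: x) = a * g x) ->
  (forall x, 0 <<= x -> 0 <= g x) ->
  exists2 psi, posfun psi & forall x, 0 <<= x -> psi x = g x.
Proof.
move=> gD gZ g0.
have g00 : g 0 = 0 by have := gZ 0 0 (lexx _) (bl_lexx BL 0); rewrite scale0r mul0r.
exists (fun x => g (pos x) - g (pos (- x))); last first.
  move=> x x0; rewrite (bl_pos_id BL)// (bl_pos_le0 BL)//.
  by rewrite g00 subr0.
split; last first.
  move=> x x0; rewrite (bl_pos_id BL)// (bl_pos_le0 BL)//.
  by rewrite g00 subr0 g0.
have D x y : g (pos (x + y)) - g (pos (- (x + y))) =
    (g (pos x) - g (pos (- x))) + (g (pos y) - g (pos (- y))).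
  have E z : pos z = z + pos (- z) by rewrite -{2}(bl_posBneg BL z) subrK.
  have : pos (x + y) + (pos (- x) + pos (- y)) =
      pos (- (x + y)) + (pos x + pos y).
    by rewrite (E (x + y)) (E x) (E y) [in RHS]addrACA [RHS]addrC addrAC.
  move=> /(congr1 g); rewrite !gD//; try by apply: (bl_ge0D BL).
  lra.
have Z a x : 0 <= a -> g (pos (a *: x)) - g (pos (- (a *: x))) =
    a * (g (pos x) - g (pos (- x))).
  by move=> a0; rewrite -scalerN !(bl_posZ BL)// !gZ// mulrBr.
move=> a x y; rewrite D; congr (_ + _); have [a0|/ltW a0] := leP 0 a.
  exact: Z.
by have := Z (- a) x; rewrite oppr_ge0 scaleNr opprK => /(_ a0); lra.
Qed.

(* [psi z = sup_t phi (z /\ t u)] is the component of [phi] in the band generated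
   by [u = pos v]; the last clause says that [psi] and [phi - psi] are disjoint. *)
Lemma posfun_split phi v : posfun phi -> exists psi,
  [/\ posfun psi, posfun (fun z => phi z - psi z),
      psi (pos (- v)) = 0, phi (pos v) - psi (pos v) = 0 &
      forall z e, 0 <<= z -> 0 < e -> exists y,
        [/\ 0 <<= y, y <<= z, psi (z - y) <= e & phi y - psi y <= 0] ].
Proof.
move=> phip; set u := pos v.
have u0 : 0 <<= u by exact: pos_ge0.
have tu0 t : 0 <= t -> 0 <<= t *: u by move=> t0; apply: (bl_ge0Z BL).
pose A z := [set phi (inf z (t *: u)) | t in [set t | 0 <= t]]%classic.
have ubA z : ubound (A z) (phi z).
  by move=> _ [t /= t0 <-]; apply: (posfun_le phip); exact: (bl_infl BL).
have huA z : has_ubound (A z) by exists (phi z).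
have neA z : (A z !=set0)%classic by exists (phi (inf z (0 *: u))); exists 0 => /=.
pose g z := reals.sup (A z).
have leg z t : 0 <= t -> phi (inf z (t *: u)) <= g z.
  by move=> t0; apply: ub_le_sup => //; exists t.
have gle z M : (forall t, 0 <= t -> phi (inf z (t *: u)) <= M) -> g z <= M.
  by move=> H; apply: ge_sup => // _ [t /= t0 <-]; exact: H.
have infu0 z t : 0 <<= z -> 0 <= t -> 0 <<= inf z (t *: u).
  by move=> z0 t0; apply: (bl_le_inf BL) => //; exact: tu0.
have g0 z : 0 <<= z -> 0 <= g z.
  by move=> z0; apply: le_trans (leg z 0 (lexx _)); apply: phip.2; exact: infu0.
(* Subadditivity comes from [bl_infDl]; conversely, the multiples t and s of u used for y and x are
   merged into s + t. *)
have gD x y : 0 <<= x -> 0 <<= y -> g (x + y) = g x + g y.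
  move=> x0 y0; apply/le_anti; apply/andP; split.
    apply: (gle) => t t0; apply: le_trans (lerD (leg x t t0) (leg y t t0)).
    by rewrite -(posfunD phip); apply: (posfun_le phip); apply: (bl_infDl BL) => //;
      exact: tu0.
  rewrite -lerBrDr; apply: (gle) => t t0; rewrite lerBrDl -lerBrDr.
  apply: (gle) => s s0; rewrite lerBrDr.
  apply: le_trans (leg _ (s + t) (addr_ge0 s0 t0)).
  rewrite -(posfunD phip); apply: (posfun_le phip).
  by rewrite scalerDl addrC [s *: u + _]addrC; exact: (bl_infD BL).
have gZle a z : 0 < a -> 0 <<= z -> g (a *: z) <= a * g z.
  move=> a0 z0; apply: (gle) => t t0.
  rewrite -ler_pdivrMl// -(posfunZ phip).
  have ta0 : 0 <= a^-1 * t by rewrite mulr_ge0// invr_ge0 ltW.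
  apply: le_trans (leg _ _ ta0); apply: (posfun_le phip).
  have a1 : 0 <= a^-1 by rewrite invr_ge0 ltW.
  apply: (bl_le_inf BL).
    rewrite -[X in _ <<= X](scale1r z) -(mulVf (lt0r_neq0 a0)) -scalerA.
    by apply: (bl_leZ BL) => //; exact: (bl_infl BL).
  by rewrite -scalerA; apply: (bl_leZ BL) => //; exact: (bl_infr BL).
have gZ a z : 0 <= a -> 0 <<= z -> g (a *: z) = a * g z.
  rewrite le_eqVlt => /predU1P[<- z0|a0 z0].
    rewrite scale0r mul0r; apply/le_anti; rewrite g0// ?andbT; last exact: (bl_lexx BL).
    by apply: (gle) => t t0; rewrite -(posfun0 phip) (posfun_le phip)//; exact: (bl_infl BL).
  apply/le_anti; rewrite gZle//= -ler_pdivlMl//.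
  apply: le_trans (gZle _ _ _ _); rewrite ?invr_gt0//; last first.
    by apply: (bl_ge0Z BL) => //; exact: ltW.
  by rewrite scalerA mulVf ?gt_eqF// scale1r.
have gphi z : g z <= phi z.
  by apply: (gle) => t t0; apply: (posfun_le phip); exact: (bl_infl BL).
have [psi psip psiE] := posfun_extend gD gZ g0.
exists psi; split=> //.
- split=> [a x y|x x0]; first by rewrite phip.1 psip.1; ring.
  by rewrite subr_ge0 psiE.
- rewrite psiE ?pos_ge0//; apply/le_anti; rewrite g0 ?pos_ge0// andbT.
  apply: (gle) => t t0; rewrite -(posfun0 phip); apply: (posfun_le phip).
  (* As c is at least 1 and t, [inf (pos (- v)) (t *: u)] is at most c times [inf (pos (- v)) u],
     which is 0. *)
  pose c := Num.max 1 t.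
  have c0 : 0 < c by rewrite lt_max ltr01.
  have <- : c *: inf (pos (- v)) u = 0.
    by have := bl_pos_disjoint BL (- v); rewrite opprK => ->; rewrite scaler0.
  have {1}-> : inf (pos (- v)) (t *: u) = c *: (c^-1 *: inf (pos (- v)) (t *: u)).
    by rewrite scalerA mulfV ?gt_eqF// scale1r.
  have ci0 : 0 <= c^-1 by rewrite invr_ge0 ltW.
  apply: (bl_leZ BL); first exact: ltW.
  apply: (bl_le_inf BL).
    apply: (bl_trans BL) (bl_leZ BL ci0 (bl_infl BL _ _)) _.
    rewrite -[X in _ <<= X]scale1r; apply/(bl_subge0 BL); rewrite -scalerBl.
    by apply: (bl_ge0Z BL) => //; rewrite subr_ge0 invf_le1// le_max lexx.
  apply: (bl_trans BL) (bl_leZ BL ci0 (bl_infr BL _ _)) _.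
  rewrite scalerA -[X in _ <<= X]scale1r; apply/(bl_subge0 BL); rewrite -scalerBl.
  by apply: (bl_ge0Z BL) => //; rewrite subr_ge0 ler_pdivrMl// mulr1 le_max lexx orbT.
- apply/eqP; rewrite psiE// eq_le subr_le0 subr_ge0 gphi andbT.
  have := leg u 1 ler01; rewrite scale1r (bl_inf_id BL)//; exact: (bl_lexx BL).
(* The witness is [inf z (t *: u)] with t almost attaining the supremum [g z]; phi and psi agree on
   it because it lies below t u. *)
- move=> z e z0 e0.
  have [_ [t /= t0 <-] gt] := sup_adherent e0 (conj (neA z) (huA z)).
  exists (inf z (t *: u)); split.
  + exact: infu0.
  + exact: (bl_infl BL).
  + rewrite (posfunB psip) (psiE z)// lerBlDr -lerBlDl ltW//.
    rewrite (lt_le_trans gt)// psiE; last exact: infu0.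
    by have := leg (inf z (t *: u)) t t0; rewrite (bl_inf_id BL)//; exact: (bl_infr BL).
  + rewrite subr_le0 psiE; last exact: infu0.
    by have := leg (inf z (t *: u)) t t0; rewrite (bl_inf_id BL)//; exact: (bl_infr BL).
Qed.

(** Disjointness in the order dual in approximate form: up to [e], each [F i] sees only its own part
    of a suitable decomposition of z. *)
Definition disjoint_family (I : finType) (F : I -> Y -> R) :=
  forall z e, 0 <<= z -> 0 < e -> exists y : I -> Y,
    [/\ forall i, 0 <<= y i, \sum_i y i = z & forall i, F i (z - y i) <= e].

(** Induction on [vs]: [posfun_split] cuts every component in two along the next vector. *)
Lemma posfun_splits phi (vs : seq Y) : posfun phi ->
  exists (I : finType) (F : I -> Y -> R),
  [/\ forall i, posfun (F i), forall z, \sum_i F i z = phi z, disjoint_family F &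
      forall v i, v \in vs -> F i (pos v) = 0 \/ F i (pos (- v)) = 0].
Proof.
move=> phip; elim: vs => [|v vs [I [F [Fp Fs Fd Fv]]]].
  exists unit, (fun _ => phi); split=> //.
    by move=> z; rewrite big_const card_unit /= addr0.
  move=> z e z0 e0; exists (fun=> z); split=> //.
    by rewrite big_const card_unit /= addr0.
  by move=> _; rewrite subrr (posfun0 phip) ltW.
have [G HG] := choice (fun i => posfun_split v (Fp i)).
(* The label [true] marks the part living on pos v, [false] the rest, which vanishes there. *)
pose F' (k : I * bool) z := if k.2 then G k.1 z else F k.1 z - G k.1 z.
have sumb (V : zmodType) (f : I * bool -> V) :
    \sum_k f k = \sum_i (f (i, true) + f (i, false)).
  rewrite (eq_bigr (fun k => f (k.1, k.2))); last by case.
  rewrite -(pair_bigA _ (fun i b => f (i, b)))/=.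
  by apply: eq_bigr => i _; rewrite big_bool.
exists (I * bool)%type, F'; split.
- by move=> [i []]; rewrite /F'/=; case: (HG i).
- by move=> z; rewrite sumb/= -Fs; apply: eq_bigr => i _; rewrite /F'/= subrKC.
- move=> z e z0 e0; have e20 : 0 < e / 2 by rewrite divr_gt0.
  have [y [y0 ys yF]] := Fd z (e / 2) z0 e20.
  have [y' Hy'] := choice (fun i => let: And5 _ _ _ _ H := HG i in H (y i) (e / 2) (y0 i) e20).
  (* Each old part [y i] is cut again by [y' i]; both cuts have error e / 2. *)
  exists (fun k => if k.2 then y' k.1 else y k.1 - y' k.1); split.
  + move=> [i []]/=; case: (Hy' i) => // _ H _ _.
    by apply/(bl_subge0 BL).
  + by rewrite sumb/= -ys; apply: eq_bigr => i _; rewrite subrKC.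
  + have H i : z = (z - y i) + y i by rewrite subrK.
    move=> [i []]; rewrite /F'/=; have [Gp FGp _ _ _] := HG i;
      have [y'0 y'y G1 G2] := Hy' i; have zy0 : 0 <<= z - y i.
    * rewrite -ys (bigD1 i)//= addrAC subrr add0r.
      by apply: (bl_ge0_sum BL).
    * have -> : z - y' i = (z - y i) + (y i - y' i) by rewrite addrA subrK.
      rewrite (posfunD Gp) [e]splitr lerD// (le_trans _ (yF i))//.
      by have := FGp.2 _ zy0; rewrite subr_ge0.
    * rewrite -ys (bigD1 i)//= addrAC subrr add0r.
      by apply: (bl_ge0_sum BL).
    * have -> : z - (y i - y' i) = (z - y i) + y' i by rewrite opprB addrA addrAC.
      have := posfunD FGp (z - y i) (y' i) => /= ->.
      have := yF i; have := Gp.2 _ zy0; lra.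
- move=> w i; rewrite inE => /orP[/eqP ->|wvs].
    case: i => i []; rewrite /F'/=; have [_ _ H1 H2 _] := HG i; [by right|by left].
  (* Both halves of [F i.1] lie between 0 and [F i.1], so they inherit its zeros on the positive
     cone. *)
  have H z : 0 <<= z -> F i.1 z = 0 -> F' i z = 0.
    move=> z0 F0; have [Gp FGp _ _ _] := HG i.1.
    have G0 := Gp.2 _ z0; have := FGp.2 _ z0; rewrite F0 sub0r oppr_ge0 => G1.
    have G2 : G i.1 z = 0 by apply/le_anti; rewrite G0 G1.
    by rewrite /F'; case: ifP => _; rewrite ?F0 G2 ?subr0.
  by have [F0|F0] := Fv _ i.1 wvs; [left|right]; apply: H.
Qed.

End positive_functionals.

(** * Lattice expressions: Lipschitz bounds and homogeneity *)

Section fvl_expressions.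
Variables (R : realType) (V : Type).

Fixpoint fvl_atoms (f : fvl_expr R V) : seq V :=
  match f with
  | FAtom x => [:: x]
  | FAdd f g => fvl_atoms f ++ fvl_atoms g
  | FScale _ f => fvl_atoms f
  | FSup f g => fvl_atoms f ++ fvl_atoms g
  end.

(** A Lipschitz constant of the evaluation for the sup distance on the atoms. Adding at [FSup]
    matches [bl_abs_sup], so the same constant serves in Banach lattices. *)
Fixpoint fvl_lip (f : fvl_expr R V) : R :=
  match f with
  | FAtom _ => 1
  | FAdd f g => fvl_lip f + fvl_lip g
  | FScale a f => `|a| * fvl_lip f
  | FSup f g => fvl_lip f + fvl_lip g
  end.

Lemma fvl_lip_ge0 f : 0 <= fvl_lip f.
Proof. by elim: f => //= *; rewrite ?addr_ge0 ?mulr_ge0. Qed.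

Lemma ler_dist_max (a b c d x y : R) : `|a - c| <= x -> `|b - d| <= y ->
  `|Num.max a b - Num.max c d| <= x + y.
Proof.
rewrite !ler_norml => /andP[? ?] /andP[? ?].
by apply/andP; case: (leP a b) => ?; case: (leP c d) => ?; split; lra.
Qed.

End fvl_expressions.

Section fvl_scalar.
Variables (R : realType) (E : normedModType R).
Implicit Types (f : fvl_expr R E) (phi psi : E -> R).

Lemma fvl_at_lip f phi psi (d : R) :
  (forall x, x \in fvl_atoms f -> `|phi x - psi x| <= d) ->
  `|fvl_at f phi - fvl_at f psi| <= fvl_lip f * d.
Proof.
elim: f => [x|f IHf g IHg|a f IHf|f IHf g IHg] /= H.
- by rewrite mul1r; apply: H; rewrite inE.
- rewrite /fvl_at/= -!/(fvl_at _ _) opprD addrACA mulrDl.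
  apply: le_trans (ler_normD _ _) _; apply: lerD.
    by apply: IHf => x xf; apply: H; rewrite mem_cat xf.
  by apply: IHg => x xg; apply: H; rewrite mem_cat xg orbT.
- by rewrite /fvl_at/= -!/(fvl_at _ _) -mulrBr normrM -mulrA ler_wpM2l// IHf.
- rewrite /fvl_at/= -!/(fvl_at _ _) mulrDl; apply: ler_dist_max.
    by apply: IHf => x xf; apply: H; rewrite mem_cat xf.
  by apply: IHg => x xg; apply: H; rewrite mem_cat xg orbT.
Qed.

Lemma fvl_atZ f (a : R) phi : 0 <= a ->
  fvl_at f (fun x => a * phi x) = a * fvl_at f phi.
Proof.
move=> a0; rewrite /fvl_at.
elim: f => //= [f -> g ->|b f ->|f -> g ->]; [by rewrite mulrDr|by rewrite mulrCA|].
by rewrite maxr_pMr.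
Qed.

Lemma le_norm_of_unit_ball (h : E -> R) :
  (forall a x, h (a *: x) = `|a| * h x) -> (forall x, `|x| <= 1 -> h x <= 1) ->
  forall x, h x <= `|x|.
Proof.
move=> hZ h1 x; have [->|x0] := eqVneq x 0.
  by rewrite normr0 -(scale0r 0) hZ normr0 mul0r.
have nx0 : 0 < `|x| by rewrite normr_gt0.
have := h1 (`|x|^-1 *: x); rewrite hZ normrZ normfV normr_id mulVf ?gt_eqF//.
by move=> /(_ (lexx _)); rewrite ler_pdivrMl// mulr1.
Qed.

End fvl_scalar.

(** * The weak norm on finite sequences *)

Section weak_norm.
Variables (R : realType) (p : R).
Local Notation th := (1 - p^-1).

Lemma wpnorm_ge0 n (a : 'I_n -> R) : 0 <= wpnorm p a.
Proof. exact: bigmax_ge_id. Qed.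

(** Clearing the negative exponent gives a form that also covers the empty set, where the left side
    is 0. *)
Lemma wpnorm_leP n (a : 'I_n -> R) (M : R) : 0 <= M ->
  wpnorm p a <= M <->
  (forall A : {set 'I_n}, \sum_(i in A) `|a i| <= M * #|A|%:R `^ th).
Proof.
move=> M0.
have E (A : {set 'I_n}) : A != finset.set0 ->
    (#|A|%:R `^ (p^-1 - 1) * \sum_(i in A) `|a i| <= M) =
    (\sum_(i in A) `|a i| <= M * #|A|%:R `^ th).
  rewrite -card_gt0 => A0; have A0' : 0 < #|A|%:R :> R by rewrite ltr0n.
  by rewrite -opprB powRN mulrC ler_pdivrMr// powR_gt0.
split=> [H A|H].
  have [->|A0] := eqVneq A finset.set0.
    by rewrite big_set0 mulr_ge0// powR_ge0.
  rewrite -E// (le_trans _ H)//; exact: (le_bigmax_cond 0 (fun A : {set 'I_n} =>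
    #|A|%:R `^ (p^-1 - 1) * \sum_(i in A) `|a i|)).
by apply: bigmax_le => // A A0; rewrite E.
Qed.

Lemma wpnorm_sum_le n (a : 'I_n -> R) (A : {set 'I_n}) :
  \sum_(i in A) `|a i| <= wpnorm p a * #|A|%:R `^ th.
Proof. by move: A; apply/wpnorm_leP => //; exact: wpnorm_ge0. Qed.

End weak_norm.

(** * Weighted families of functionals *)

Section weighted_bound.
Variables (R : realType) (p : R) (p1 : 1 < p) (E : normedModType R).
Variables (f : fvl_expr R E) (r : R).
Hypothesis rho_le : (rho_pinf p f <= r%:E)%E.
Local Notation th := (1 - p^-1).
Local Notation islinear psi :=
  (forall (a : R) (u v : E), psi (a *: u + v) = a * psi u + psi v).

Let p0 : 0 < p := lt_trans ltr01 p1.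

Lemma conj_exp_itv : 0 < th < 1.
Proof.
by rewrite subr_gt0 invf_lt1// p1 ltrBlDr ltrDl invr_gt0.
Qed.

Let th_gt0 : 0 < th. Proof. by case/andP: conj_exp_itv. Qed.

(** The empty family is admissible and contributes the value 0. *)
Lemma rho_pinf_ge0 : 0 <= r.
Proof.
rewrite -lee_fin (le_trans _ rho_le)//.
have H : 0 <= wpnorm p (fun i : 'I_0 => fvl_at f ((fun=> fun=> 0) i)) by exact: wpnorm_ge0.
apply: (@le_trans _ _ (wpnorm p (fun i : 'I_0 => fvl_at f ((fun=> fun=> 0) i)))%:E).
  by rewrite lee_fin.
apply: ereal_sup_ubound; exists 0, (fun _ _ => 0); split; first by case.
by split=> // x _; apply/wpnorm_leP => // A; rewrite big1 ?mul1r ?powR_ge0//; case.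
Qed.

Lemma islinearZ (psi : E -> R) a x : islinear psi -> psi (a *: x) = a * psi x.
Proof.
move=> lpsi; have psi0 : psi 0 = 0.
  by have := lpsi 1 0 0; rewrite scaler0 addr0 mul1r => /eqP; rewrite addrC -subr_eq subrr => /eqP.
by have := lpsi a x 0; rewrite psi0 !addr0.
Qed.

(** After renumbering [J], singletons put each [psi j] in the dual ball and all [S] together make
    the family admissible; the full index set gives the bound. *)
Lemma sum_fvl_le_card (J : finType) (psi : J -> E -> R) :
  (forall j, islinear (psi j)) ->
  (forall x, `|x| <= 1 ->
     forall S : {set J}, \sum_(j in S) `|psi j x| <= #|S|%:R `^ th) ->
  \sum_j `|fvl_at f (psi j)| <= r * #|J|%:R `^ th.
Proof.
move=> lpsi H; pose xs (i : 'I_#|J|) := psi (enum_val i).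
have le_r : wpnorm p (fun i => fvl_at f (xs i)) <= r.
  rewrite -lee_fin (le_trans _ rho_le)//; apply: ereal_sup_ubound.
  exists #|J|, xs; split; last split=> //.
    move=> i; split; first exact: lpsi.
    apply: (@le_norm_of_unit_ball _ _ (fun x => `|xs i x|)).
      by move=> a x; rewrite /xs (islinearZ _ _ (lpsi _)) normrM.
    move=> x x1; have := H x x1 [set enum_val i]%SET.
    by rewrite big_set1 cards1 powR1.
  move=> x x1; apply/wpnorm_leP => // A.
  have inj : {in A &, injective (@enum_val _ J)} by move=> i j _ _; exact: enum_val_inj.
  have := H x x1 [set enum_val i | i in A]%SET.
  by rewrite (big_imset (fun j => `|psi j x|) inj)/= card_in_imset// mul1r.
have := (wpnorm_leP p _ rho_pinf_ge0).1 le_r [set: 'I_#|J|]%SET; rewrite cardsT card_ord.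
apply: le_trans; rewrite [leRHS](eq_bigl predT); last by move=> i; rewrite inE.
rewrite (reindex (@enum_val _ J)) //=.
by apply: onW_bij; exact: enum_val_bij.
Qed.

(* A weight [m i] is replaced by the integer part of [m i / d] copies of the
   functional [d `^ (- th) * (d / m i) * psi i], each of weight [d]. *)
Lemma sum_fvl_le_weight (I : finType) (m : I -> R) (psi : I -> E -> R) :
  (forall i, 0 <= m i) -> (forall i, islinear (psi i)) ->
  (forall x, `|x| <= 1 -> forall S : {set I},
     \sum_(i in S) `|psi i x| <= (\sum_(i in S) m i) `^ th) ->
  \sum_i `|fvl_at f (psi i)| <= r * (\sum_i m i) `^ th.
Proof.
move=> m0 lpsi H.
(* If the sum X exceeded the bound B, eta = (X - B) / (2 X) would give (X + B) / 2 <= B, a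
   contradiction. *)
suff step eta : 0 < eta < 1 ->
    (1 - eta) * \sum_i `|fvl_at f (psi i)| <= r * (\sum_i m i) `^ th.
  set X := \sum_i `|_|; set B := _ * _.
  have X0 : 0 <= X by apply: sumr_ge0.
  have B0 : 0 <= B by rewrite mulr_ge0 ?rho_pinf_ge0 ?powR_ge0.
  rewrite leNgt; apply/negP => BX.
  have X1 : 0 < X by exact: le_lt_trans BX.
  have := step ((X - B) / (2 * X)); rewrite -/X -/B.
  have -> : (1 - (X - B) / (2 * X)) * X = (X + B) / 2 by field; rewrite gt_eqF.
  rewrite divr_gt0 ?subr_gt0 ?mulr_gt0// ltr_pdivrMr ?mulr_gt0//.
  have -> : X - B < 1 * (2 * X) by lra.
  move=> /(_ isT); lra.
move=> /andP[eta0 eta1].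
(* Rounding a positive weight down to a multiple of [d] loses at most the fraction [eta] of it; the
   1 keeps [d] positive when every weight is 0. *)
pose d := eta * \big[Num.min/1]_(i | 0 < m i) m i.
have d0 : 0 < d by rewrite mulr_gt0// lt_bigmin.
have dm i : 0 < m i -> d <= eta * m i.
  by move=> mi; rewrite ler_wpM2l ?(ltW eta0)//; exact: (bigmin_le_cond 1 m).
pose N i := Num.truncn (m i / d).
have N1 i : (N i)%:R * d <= m i.
  by rewrite -ler_pdivlMr//; case/andP: (truncn_itv (divr_ge0 (m0 i) (ltW d0))).
have N2 i : 0 < m i -> (1 - eta) * m i <= (N i)%:R * d.
  move=> mi; have := truncn_itv (divr_ge0 (m0 i) (ltW d0)) => /andP[_].
  by rewrite ltr_pdivrMr// -natr1 -/(N i) => h; have := dm i mi; lra.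
pose J := {i : I & 'I_(N i)}.
pose c i := d `^ (- th) * (d / m i).
have c0 i : 0 <= c i by rewrite mulr_ge0 ?powR_ge0// divr_ge0// ltW.
pose Psi (j : J) x := c (tag j) * psi (tag j) x.
pose b (S : {set J}) i := #|[set k : 'I_(N i) | Tagged (fun i => 'I_(N i)) k \in S]%SET|.
have sumJ (S : {set J}) (G : I -> R) :
    \sum_(j in S) G (tag j) = \sum_i (b S i)%:R * G i.
  rewrite (eq_bigl (fun j : J => predT (tag j) &&
    (Tagged (fun i => 'I_(N i)) (tagged j) \in S))); last by case.
  rewrite -(@sig_big_dep _ _ _ _ (fun i => 'I_(N i)) predT
    (fun i k => Tagged (fun i => 'I_(N i)) k \in S) (fun i _ => G i)).
  apply: eq_bigr => i _.
  by rewrite sumr_const mulr_natl; congr (_ *+ _); apply: eq_card => k; rewrite inE.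
have bN S i : (b S i <= N i)%N by rewrite (leq_trans (max_card _))// card_ord.
have bT i : b [set: J]%SET i = N i.
  by rewrite -[RHS]card_ord; apply: eq_card => k; rewrite !inE.
have cardS (S : {set J}) : #|S|%:R = \sum_i (b S i)%:R :> R.
  rewrite -sumr_const (sumJ S (fun=> 1)).
  by apply: eq_bigr => i _; rewrite mulr1.
have dd : d `^ (- th) * d `^ th = 1.
  by rewrite powRN mulVf// gt_eqF// powR_gt0.
have HPsi x : `|x| <= 1 -> forall S : {set J},
    \sum_(j in S) `|Psi j x| <= #|S|%:R `^ th.
  move=> x1 S.
  have -> : \sum_(j in S) `|Psi j x| =
      d `^ (- th) * \sum_i ((b S i)%:R * d) * (`|psi i x| / m i).
    under eq_bigr do rewrite normrM (ger0_norm (c0 _)).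
    rewrite (sumJ S (fun i => c i * `|psi i x|)) mulr_sumr; apply: eq_bigr => i _.
    by rewrite /c; ring.
  (* The copies of i chosen by S act as a fractional weight between 0 and [m i], as in
     [sum_le_powR_sum]. *)
  have : \sum_i ((b S i)%:R * d) * (`|psi i x| / m i) <=
      (\sum_i (b S i)%:R * d) `^ th.
    apply: (sum_le_powR_sum (m := m)); first exact: conj_exp_itv.
    - move=> i; rewrite mulr_ge0 ?(ltW d0)//=; apply: le_trans (N1 i).
      by rewrite ler_wpM2r ?ler_nat// ltW.
    - move=> S'; apply: le_trans (H x x1 S'); apply: ler_sum => i _.
      have [->|mi] := eqVneq (m i) 0; first by rewrite mul0r.
      by rewrite mulrCA mulfV// mulr1.
  rewrite -mulr_suml -cardS powRM ?ler0n ?(ltW d0)// => h.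
  apply: le_trans (ler_wpM2l (powR_ge0 d (- th)) h) _.
  by rewrite mulrCA dd mulr1.
have lPsi j : islinear (Psi j) by move=> a u v; rewrite /Psi lpsi; ring.
have := sum_fvl_le_card lPsi HPsi.
have -> : \sum_j `|fvl_at f (Psi j)| =
    d `^ (- th) * \sum_i ((N i)%:R * d / m i * `|fvl_at f (psi i)|).
  under eq_bigr do rewrite (fvl_atZ _ _ (c0 _)) normrM (ger0_norm (c0 _)).
  rewrite (eq_bigl (fun j => j \in [set: J]%SET)); last by move=> j; rewrite inE.
  rewrite (sumJ _ (fun i => c i * `|fvl_at f (psi i)|)) mulr_sumr.
  by apply: eq_bigr => i _; rewrite bT /c; ring.
move=> /(ler_wpM2r (powR_ge0 d th)).
rewrite mulrAC dd mul1r -mulrA -powRM ?ler0n ?(ltW d0)// => h.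
apply: le_trans (le_trans h _).
  rewrite mulr_sumr; apply: ler_sum => i _.
  have := m0 i; rewrite le_eqVlt => /predU1P[mi0|mi].
    (* A functional of weight 0 vanishes, by the hypothesis for a singleton, and then so does the
       value of f at it. *)
    suff -> : fvl_at f (psi i) = 0 by rewrite normr0 !mulr0.
    have psi0 x : psi i x = 0.
      apply/eqP; rewrite -normr_le0.
      have [->|x0] := eqVneq x 0; first by rewrite -(scale0r 0) islinearZ// mul0r normr0.
      have nx0 : 0 < `|x| by rewrite normr_gt0.
      have := H (`|x|^-1 *: x); rewrite normrZ normfV normr_id mulVf ?gt_eqF//.
      move=> /(_ (lexx _) [set i]%SET); rewrite !big_set1 -mi0 powR0 ?gt_eqF//.
      by rewrite islinearZ// normrM pmulr_rle0// normr_gt0 invr_eq0 gt_eqF.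
    have -> : psi i = (fun x => 0 * psi i x) by apply/funext => x; rewrite psi0 mulr0.
    by rewrite fvl_atZ// mul0r.
  by rewrite ler_wpM2r// ler_pdivlMr//; exact: N2.
rewrite ler_wpM2l ?rho_pinf_ge0// ge0_ler_powR ?(ltW th_gt0)//.
- by rewrite nnegrE mulr_ge0// ltW.
- by rewrite nnegrE; apply: sumr_ge0.
- rewrite -cardsT cardS mulr_suml; apply: ler_sum => i _; by rewrite bT.
Qed.

End weighted_bound.

(** * Banach lattices with an upper p-estimate *)

Section upper_estimate.
Variables (R : realType) (p : R) (p1 : 1 < p) (Y : completeNormedModType R).
Variables (le : Y -> Y -> Prop) (sup : Y -> Y -> Y).
Hypothesis BL : is_banach_lattice le sup.
Implicit Types (y z u v w : Y) (a t : R) (phi psi : Y -> R).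

Local Notation "x <<= y" := (le x y) (at level 70, no associativity).
Local Notation abs := (bl_abs sup).
Local Notation inf := (bl_inf sup).
Local Notation pos := (bl_pos sup).
Local Notation posfun := (posfun le).
Local Notation th := (1 - p^-1).

Let p0 : 0 < p := lt_trans ltr01 p1.
Let th_gt0 : 0 < th. Proof. by case/andP: (conj_exp_itv p1). Qed.

(** Hahn-Banach for the sublinear norm of [pos x]: a functional below it is at most 0 at - x for x
    >= 0, hence positive. *)
Lemma posfun_norming w : 0 <<= w -> exists phi,
  [/\ posfun phi, forall x, 0 <<= x -> phi x <= `|x| & phi w = `|w|].
Proof.
move=> w0; have sq : sublinear (fun x : Y => `|pos x|).
  split=> [x y|a x a0]; last by rewrite (bl_posZ BL)// normrZ ger0_norm.
  apply: le_trans (ler_normD _ _); apply: (bl_norm_le BL).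
    exact: (bl_pos_ge0 BL).
  exact: (bl_posD BL).
have [phi [phil phile phiw]] := hahn_banach w sq.
exists phi; split.
- split=> // x x0; have := phile (- x); rewrite (bl_pos_le0 BL)// normr0.
  have phi0 : phi 0 = 0.
    have := phil 1 0 0; rewrite scaler0 addr0 mul1r => /eqP.
    by rewrite addrC -subr_eq subrr => /eqP.
  by have := phil (-1) x 0; rewrite phi0 scaleN1r !addr0 mulN1r => ->; rewrite oppr_le0.
- by move=> x x0; rewrite (le_trans (phile x))// (bl_pos_id BL).
- by rewrite phiw (bl_pos_id BL).
Qed.

Section disjoint_pieces.
Variables (I : finType) (F : I -> Y -> R).
Hypothesis Fp : forall i, posfun (F i).
Hypothesis Fd : disjoint_family le F.

(** The witness is the sum over [S] of the parts of z in a decomposition with error [e / n] per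
    functional. *)
Lemma disjoint_family_sub (S : {set I}) z e : 0 <<= z -> 0 < e -> exists y,
  [/\ 0 <<= y, y <<= z, \sum_(i in S) F i (z - y) <= e &
      \sum_(i in ~: S) F i y <= e].
Proof.
move=> z0 e0; pose n : R := #|I|%:R + 1.
have n0 : 0 < n by rewrite ltr_wpDl.
have en0 : 0 < e / n by rewrite divr_gt0.
have [y [y0 ys yF]] := Fd z0 en0.
have sum_le (A : {set I}) (h : I -> R) : (forall i, i \in A -> h i <= e / n) ->
    \sum_(i in A) h i <= e.
  move=> H; apply: (@le_trans _ _ (\sum_(i in A) e / n)); first exact: ler_sum.
  rewrite sumr_const -mulr_natr -mulrA ger_pMr// ler_pdivrMl// mulr1.
  by rewrite (le_trans (_ : _ <= #|I|%:R))// ?ler_nat ?max_card// lerDl.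
have Sc : z = \sum_(i in S) y i + \sum_(i in ~: S) y i.
  rewrite -ys (bigID (fun i => i \in S))/=; congr (_ + _).
  by apply: eq_bigl => i; rewrite inE.
have sub (A : {set I}) i : i \in A -> y i <<= \sum_(i in A) y i.
  move=> iA; rewrite (bigD1 i)//= -{1}[y i]addr0.
  by apply: (bl_leD BL); [exact: (bl_lexx BL)|exact: (bl_ge0_sum BL)].
exists (\sum_(i in S) y i); split.
- exact: (bl_ge0_sum BL).
- apply/(bl_subge0 BL); rewrite Sc addrAC subrr add0r; exact: (bl_ge0_sum BL).
- apply: sum_le => i iS; apply: le_trans (yF i); apply: (posfun_le BL (Fp i)).
  by apply: (bl_leD BL); [exact: (bl_lexx BL)|apply: (bl_leN BL); exact: sub].
- apply: sum_le => i iS; apply: le_trans (yF i); apply: (posfun_le BL (Fp i)).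
  apply/(bl_subge0 BL); rewrite addrAC Sc [X in X - _ - _]addrC addrK.
  by apply/(bl_subge0 BL); exact: sub.
Qed.

Hypothesis UP : upper_p_estimate p sup.
Hypothesis Fle : forall z, 0 <<= z -> \sum_i F i z <= `|z|.

(** Replace z and w by parts z' and w' that almost carry the functionals in [S] and in its
    complement. The disjoint positive and negative parts of w' - t z' have norms at most 1 and t, so
    the upper p-estimate bounds their sum, hence the family on it. *)
Lemma disjoint_family_upper (S : {set I}) w z t :
  0 <<= w -> `|w| <= 1 -> 0 <<= z -> `|z| <= 1 -> 0 <= t ->
  \sum_(i in ~: S) F i w + t * \sum_(i in S) F i z <= (1 + t `^ p) `^ p^-1.
Proof.
move=> w0 w1 z0 z1 t0; apply/ler_addgt0Pr => eps eps0.
have t1 : 0 < 1 + t by rewrite ltr_pwDl.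
(* Each of the two lower bounds below loses e + t e, in total [eps]. *)
pose e := eps / (2 * (1 + t)).
have e0 : 0 < e by rewrite divr_gt0// mulr_gt0.
have [z' [z'0 z'z zS zSc]] := disjoint_family_sub S z0 e0.
have [w' [w'0 w'w]] := disjoint_family_sub (~: S) w0 e0.
rewrite finset.setCK => wSc wS.
pose v := w' - t *: z'.
have FS (A : {set I}) := posfun_bigsum (fun i => i \in A) Fp.
have [a1 a2] : \sum_(i in ~: S) F i w - e - t * e <= \sum_(i in ~: S) F i (pos v) /\
    t * \sum_(i in S) F i z - t * e - e <= \sum_(i in S) F i (pos (- v)).
  split.
    apply: le_trans (posfun_le BL (FS _) (bl_le_pos BL v)).
    rewrite (posfunB (FS _)) (posfunZ (FS _)).
    move: wSc; rewrite (posfunB (FS (~: S))) => wSc.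
    by have := ler_wpM2l t0 zSc; lra.
  apply: le_trans (posfun_le BL (FS _) (bl_le_pos BL (- v))).
  rewrite opprB (posfunB (FS _)) (posfunZ (FS _)).
  move: zS; rewrite (posfunB (FS S)) => zS.
  by have := ler_wpM2l t0 zS; lra.
have Fsum x : 0 <<= x -> \sum_(i in S) F i x + \sum_(i in ~: S) F i x <= `|x|.
  move=> x0; apply: le_trans (Fle x0); rewrite [leRHS](bigID (fun i => i \in S))/=.
  by rewrite lerD2l le_eqVlt; apply/orP; left; apply/eqP; apply: eq_bigl => i; rewrite inE.
have pge0 := bl_pos_ge0 BL.
have F0 (A : {set I}) x : 0 <<= x -> 0 <= \sum_(i in A) F i x.
  by move=> x0; exact: (FS A).2.
have n1 : `|pos v| <= 1.
  apply: le_trans w1; apply: (bl_norm_le BL) => //; apply: (bl_pos_le BL) => //.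
  apply: (bl_trans BL) w'w; apply/(bl_subge0 BL); rewrite opprB addrC subrK.
  exact: (bl_ge0Z BL).
have n2 : `|pos (- v)| <= t.
  have -> : t = `|t *: z| + t * (1 - `|z|) by rewrite normrZ ger0_norm//; ring.
  apply: ler_wpDr; first by rewrite mulr_ge0 ?subr_ge0.
  apply: (bl_norm_le BL) => //; apply: (bl_pos_le BL); last exact: (bl_ge0Z BL).
  apply: (bl_trans BL) (bl_leZ BL t0 z'z).
  by apply/(bl_subge0 BL); rewrite opprB opprB addrC subrK.
pose d (i : 'I_2) := if i == ord0 then pos v else pos (- v).
have dd i j : i != j -> inf (abs (d i)) (abs (d j)) = 0.
  rewrite !(bl_abs_id BL); try by rewrite /d; case: ifP.
  have disj := bl_pos_disjoint BL v; have disj' := bl_pos_disjoint BL (- v).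
  rewrite opprK in disj'.
  by case: i => -[|[|//]] /= ?; case: j => -[|[|//]] /= ?.
have := UP dd; rewrite !big_ord_recl !big_ord0 !addr0 /d/= => up.
have up2 : `|pos v + pos (- v)| <= (1 + t `^ p) `^ p^-1.
  apply: (le_trans up); apply: ge0_ler_powR.
  - by rewrite invr_ge0 ltW.
  - by rewrite nnegrE addr_ge0 ?powR_ge0.
  - by rewrite nnegrE addr_ge0 ?powR_ge0.
  - apply: lerD; last by apply: ge0_ler_powR; rewrite ?nnegrE// ltW.
    by rewrite (le_trans (ge0_ler_powR (ltW p0) _ _ n1)) ?nnegrE ?powR1.
have := Fsum (pos v + pos (- v)) (bl_ge0D BL (pge0 _) (pge0 _)).
rewrite !(posfunD (FS _)).
have := F0 S _ (pge0 v); have := F0 (~: S) _ (pge0 (- v)).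
have -> : eps = 2 * (1 + t) * e by rewrite /e; field; rewrite gt_eqF.
move: a1 a2 up2; clear; lra.
Qed.

(* With [a] the left side and [mu = \sum_(i in S) F i w], the previous lemma gives
   [t a <= mu + t `^ p / p] for all [t >= 0]; take [t = a `^ (q - 1)]. *)
Lemma disjoint_family_weak (S : {set I}) w z :
  0 <<= w -> `|w| <= 1 -> \sum_i F i w = 1 -> 0 <<= z -> `|z| <= 1 ->
  \sum_(i in S) F i z <= (\sum_(i in S) F i w / th) `^ th.
Proof.
move=> w0 w1 Fw z0 z1; set a := \sum_(i in S) F i z.
rewrite -mulr_suml; set mu := \sum_(i in S) F i w.
have a0 : 0 <= a by apply: sumr_ge0 => i _; exact: (Fp i).2.
have mu0 : 0 <= mu by apply: sumr_ge0 => i _; exact: (Fp i).2.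
(* As [th^-1] is the conjugate exponent q, both a t and t^p equal a^q. *)
pose t := a `^ (th^-1 - 1).
have t0 : 0 <= t by exact: powR_ge0.
have ta : a * t = a `^ th^-1 by rewrite mulr_powRB1// invr_gt0.
have tp : t `^ p = a `^ th^-1.
  rewrite /t -powRrM; congr (_ `^ _).
  have p_neq0 : p != 0 by rewrite gt_eqF.
  have pm1 : p - 1 != 0 by rewrite gt_eqF// subr_gt0.
  by field; rewrite p_neq0 pm1.
have := disjoint_family_upper S w0 w1 z0 z1 t0.
have -> : \sum_(i in ~: S) F i w = 1 - mu.
  rewrite -Fw [in RHS](bigID (fun i => i \in S))/= -/mu [mu + _]addrC addrK.
  by apply: eq_bigl => i; rewrite inE.
rewrite -/a [t * a]mulrC ta tp.
have i01 : 0 < p^-1 < 1 by rewrite invr_gt0 p0 invf_lt1.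
have a1 : 0 <= 1 + a `^ th^-1 by rewrite addr_ge0// powR_ge0.
(* The tangent of x^(1/p) at 1 bounds the right side by 1 + a^q / p. *)
have := powR_tangent i01 a1 ltr01; rewrite !powR1 mulr1.
set b := a `^ th^-1; set c := (1 + b) `^ _ => c1 c2.
have tb : b * th <= mu by lra.
have -> : a = b `^ th by rewrite -powRrM mulVf ?powRr1// gt_eqF.
apply: ge0_ler_powR; first exact: ltW.
- by rewrite nnegrE powR_ge0.
- by rewrite nnegrE divr_ge0// ltW.
- by rewrite ler_pdivlMr.
Qed.

End disjoint_pieces.

(** Take the least k such that G vanishes on the part of y above [l k *: e]. If k > 0, minimality
    makes G vanish on the part below the previous level, which is only eta e lower. The levels start
    at -1 and reach 1, which covers y. *)
Lemma level_approx (G : Y -> R) y e (eta : R) (N : nat) : posfun G -> abs y <<= e ->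
  0 < eta -> 2 <= N%:R * eta ->
  (forall k, (k <= N)%N -> let v := y - (k%:R * eta - 1) *: e in
     G (pos v) = 0 \/ G (pos (- v)) = 0) ->
  exists lam : R, G (abs (y - lam *: e)) <= eta * G e.
Proof.
move=> Gp ye eta0 Neta H; pose l (k : nat) := k%:R * eta - 1.
have e0 : 0 <<= e by apply: (bl_trans BL) ye; exact: (bl_abs_ge0 BL).
have exk : exists k, (k <= N)%N && (G (pos (y - l k *: e)) == 0).
  exists N; rewrite leqnn/=.
  have -> : y - l N *: e = - (l N *: e - y) by rewrite opprB.
  rewrite (bl_pos_le0 BL) ?(posfun0 Gp)//; apply/(bl_subge0 BL).
  apply: (bl_trans BL) (bl_trans BL (bl_le_abs BL y) ye) _.
  rewrite -{1}[e]scale1r; apply/(bl_subge0 BL); rewrite -scalerBl.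
  by apply: (bl_ge0Z BL) => //; rewrite /l; lra.
case: (ex_minnP exk) => k /andP[kN /eqP Gk] kmin.
exists (l k); rewrite (bl_absE BL) (posfunD Gp) Gk add0r.
case: k kN Gk kmin => [|k] kN Gk kmin.
  (* At the lowest level the negative part is zero because - y <= e. *)
  have -> : l 0 = -1 by rewrite /l mul0r add0r.
  rewrite scaleN1r opprK (bl_pos_le0 BL) ?(posfun0 Gp).
    by rewrite mulr_ge0 ?(ltW eta0)//; exact: Gp.2.
  rewrite addrC -[y]opprK; apply/(bl_subge0 BL).
  exact: (bl_trans BL) (bl_leN_abs BL y) ye.
have Gk' : G (pos (- (y - l k *: e))) = 0.
  have [G0|//] := H k (ltnW kN).
  by have := kmin k; rewrite (ltnW kN) G0 eqxx => /(_ isT); rewrite ltnn.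
rewrite -(posfunZ Gp) -[leRHS]add0r -Gk' -(posfunD Gp).
apply: (posfun_le BL Gp).
have -> : - (y - l k.+1 *: e) = - (y - l k *: e) + eta *: e.
  rewrite !opprB addrAC -scalerDl; congr (_ *: _ - _); rewrite /l -natr1; ring.
rewrite -{2}[eta *: e](bl_pos_id BL); first exact: (bl_posD BL).
by apply: (bl_ge0Z BL) => //; exact: ltW.
Qed.

(** On multiples of the positive vector e the lattice operations act on the scalars, so f at the
    [lam x *: e] is [fvl_at f lam *: e]; errors propagate by induction. *)
Lemma fvl_eval_approx (E : normedModType R) (f : fvl_expr R E) (T : E -> Y)
    (G : Y -> R) e (lam : E -> R) (d : R) : posfun G -> 0 <<= e ->
  (forall x, x \in fvl_atoms f -> G (abs (T x - lam x *: e)) <= d) ->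
  G (abs (fvl_eval +%R *:%R sup T f - fvl_at f lam *: e)) <= fvl_lip f * d.
Proof.
move=> Gp e0; elim: f => [x|f IHf g IHg|a f IHf|f IHf g IHg] /= H.
- by rewrite mul1r; apply: H; rewrite inE.
- rewrite /fvl_at/= -!/(fvl_at _ _) mulrDl scalerDl opprD addrACA.
  apply: le_trans (posfun_le BL Gp (bl_absD BL _ _)) _.
  rewrite (posfunD Gp); apply: lerD.
    by apply: IHf => x xf; apply: H; rewrite mem_cat xf.
  by apply: IHg => x xg; apply: H; rewrite mem_cat xg orbT.
- rewrite /fvl_at/= -!/(fvl_at _ _) -scalerA -scalerBr (bl_absZ BL) (posfunZ Gp).
  by rewrite -mulrA ler_wpM2l// IHf.
- rewrite /fvl_at/= -!/(fvl_at _ _) mulrDl -(bl_sup_max BL)//.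
  apply: le_trans (posfun_le BL Gp (bl_abs_sup BL _ _ _ _)) _.
  rewrite (posfunD Gp); apply: lerD.
    by apply: IHf => x xf; apply: H; rewrite mem_cat xf.
  by apply: IHg => x xg; apply: H; rewrite mem_cat xg orbT.
Qed.

(** G need not be a lattice homomorphism, but near multiples of e it almost is one: both sides are
    compared with the absolute value of [G e * fvl_at f lam], each at the cost of one error
    [fvl_lip f * d]. *)
Lemma posfun_fvl_eval_le (E : normedModType R) (f : fvl_expr R E) (T : E -> Y)
    (G : Y -> R) e (lam : E -> R) (d : R) : posfun G -> 0 <<= e ->
  (forall x, x \in fvl_atoms f -> G (abs (T x - lam x *: e)) <= d) ->
  G (abs (fvl_eval +%R *:%R sup T f)) <=
    `|fvl_at f (fun x => G (T x))| + 2 * (fvl_lip f * d).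
Proof.
move=> Gp e0 H; have H1 := fvl_eval_approx Gp e0 H.
have H2 : `|fvl_at f (fun x => G (T x)) - fvl_at f (fun x => G e * lam x)| <=
    fvl_lip f * d.
  apply: fvl_at_lip => x xf; apply: le_trans (H x xf).
  by rewrite mulrC -(posfunZ Gp) -(posfunB Gp) (posfun_abs BL).
have Ge0 : 0 <= G e by exact: Gp.2.
rewrite fvl_atZ// in H2; set c := fvl_at f lam in H1 H2 *.
set h := fvl_eval _ _ _ _ _ in H1 *.
have H3 : G (abs h) <= G (abs (h - c *: e)) + `|G e * c|.
  have -> : `|G e * c| = G (abs (c *: e)).
    by rewrite (bl_absZ BL) (posfunZ Gp) normrM (ger0_norm Ge0) (bl_abs_id BL)// mulrC.
  by rewrite -(posfunD Gp); apply: (posfun_le BL Gp); rewrite -{1}[h](subrK (c *: e));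
    exact: (bl_absD BL).
have H4 : `|G e * c| <= `|fvl_at f (fun x => G (T x))| + fvl_lip f * d.
  rewrite -lerBlDl; apply: le_trans H2; rewrite distrC.
  exact: lerB_dist.
lra.
Qed.

Lemma norm_fvl_eval_le (E : normedModType R) (f : fvl_expr R E) (T : E -> Y) (r : R) :
  upper_p_estimate p sup -> Defs.is_contraction T -> (rho_pinf p f <= r%:E)%E ->
  `|fvl_eval +%R *:%R sup T f| <= gamma_p p * r.
Proof.
move=> UP [Tl Tc] rho_le; set h := fvl_eval _ _ _ _ _.
have r0 := rho_pinf_ge0 rho_le.
have g0 : 0 <= gamma_p p by exact: powR_ge0.
have [->|h0] := eqVneq h 0; first by rewrite normr0 mulr_ge0.
have nh0 : 0 < `|h| by rewrite normr_gt0.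
pose w := `|h|^-1 *: abs h.
have w0 : 0 <<= w.
  by apply: (bl_ge0Z BL); rewrite ?invr_ge0//; exact: (bl_abs_ge0 BL).
have w1 : `|w| = 1.
  by rewrite normrZ (bl_norm_abs BL) normfV normr_id mulVf// gt_eqF.
have [phi [phip phile phiw]] := posfun_norming w0.
have phih : phi (abs h) = `|h|.
  by move: phiw; rewrite (posfunZ phip) w1 => /(canRL (mulKf _)) ->;
    rewrite ?invr_eq0 ?gt_eqF// invrK mulr1.
(* A common scale dominating every generator, as [level_approx] requires. *)
pose e := \sum_(x <- fvl_atoms f) abs (T x).
have e0 : 0 <<= e.
  rewrite /e; elim/big_ind : _ => [|u v|x _]; first exact: (bl_lexx BL).
    exact: (bl_ge0D BL).
  exact: (bl_abs_ge0 BL).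
have Te x : x \in fvl_atoms f -> abs (T x) <<= e.
  rewrite /e; elim: (fvl_atoms f) => // y s IH.
  have s0 : 0 <<= \sum_(x <- s) abs (T x).
    elim/big_ind : _ => [|u v|z _]; first exact: (bl_lexx BL).
      exact: (bl_ge0D BL).
    exact: (bl_abs_ge0 BL).
  rewrite inE big_cons => /predU1P[->|/IH xs].
    by rewrite -{1}[abs _]addr0; apply: (bl_leD BL) => //; exact: (bl_lexx BL).
  rewrite -{1}[abs (T x)]add0r; apply: (bl_leD BL) => //; exact: (bl_abs_ge0 BL).
(* The errors of the components sum to [C * eta], whatever the number of components. *)
pose C := 2 * fvl_lip f * phi e.
have C0 : 0 <= C by rewrite !mulr_ge0 ?fvl_lip_ge0//; exact: phip.2.
suff step eta : 0 < eta -> `|h| <= gamma_p p * r + C * eta.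
  apply/ler_addgt0Pr => eps eps0.
  have C1 : 0 < C + 1 by rewrite ltr_wpDl.
  have := step (eps / (C + 1)); rewrite divr_gt0// => /(_ isT) /le_trans; apply.
  by rewrite lerD2l mulrCA ger_pMr// ler_pdivrMr// mul1r lerDl.
move=> eta0; pose N := (Num.truncn (2 / eta)).+1.
have Neta : 2 <= N%:R * eta.
  rewrite -ler_pdivrMr// ltW//.
  by have /andP[] := truncn_itv (divr_ge0 (ler0n R 2) (ltW eta0)).
(* Generators minus levels; the N + 1 levels run from -1 in steps of [eta] to at least 1. *)
pose vs := [seq T x - (k%:R * eta - 1) *: e | x <- fvl_atoms f, k <- iota 0 N.+1].
have [I [F [Fp Fs Fd Fv]]] := posfun_splits BL vs phip.
have Fle z : 0 <<= z -> \sum_i F i z <= `|z| by rewrite Fs; exact: phile.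
have Fw : \sum_i F i w = 1 by rewrite Fs phiw.
have lamP i x : exists lam : R, x \in fvl_atoms f ->
    F i (abs (T x - lam *: e)) <= eta * F i e.
  have [xf|] := boolP (x \in fvl_atoms f); last by exists 0.
  have [|lam Hlam] := level_approx (Fp i) (Te x xf) eta0 Neta; last by exists lam.
  move=> k kN; apply: Fv; apply/allpairsP; exists (x, k); split=> //.
  by rewrite mem_iota add0n ltnS.
have F_le i : F i (abs h) <= `|fvl_at f (fun x => F i (T x))| +
    2 * (fvl_lip f * (eta * F i e)).
  have [lam Hlam] := choice (lamP i).
  exact: (posfun_fvl_eval_le (Fp i) e0 Hlam).
(* Division by [th] is multiplication by q; [disjoint_family_weak] makes these weights
   admissible. *)
have bound := sum_fvl_le_weight p1 rho_le (m := fun i => F i w / th)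
  (psi := fun i x => F i (T x)).
rewrite -phih -Fs.
apply: (@le_trans _ _ (\sum_i (`|fvl_at f (fun x => F i (T x))| +
    2 * (fvl_lip f * (eta * F i e))))); first by apply: ler_sum => i _; exact: F_le.
rewrite big_split/=; apply: lerD; last first.
  by rewrite -!mulr_sumr Fs /C le_eqVlt; apply/orP; left; apply/eqP; ring.
apply: (le_trans (bound _ _ _)).
- by move=> i; rewrite divr_ge0 ?(ltW th_gt0)//; exact: (Fp i).2.
- by move=> i a u v; rewrite Tl (Fp i).1.
- move=> x x1 S.
  have Tx1 : `|abs (T x)| <= 1 by rewrite (bl_norm_abs BL) (le_trans (Tc x)).
  have w1' : `|w| <= 1 by rewrite w1.
  have := disjoint_family_weak Fp Fd UP Fle S w0 w1' Fw (bl_abs_ge0 BL _) Tx1.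
  by apply: le_trans; apply: ler_sum => i _; exact: (posfun_abs BL).
(* The total weight is 1/[th], and its power with exponent [th] is [gamma_p p]. *)
- rewrite -mulr_suml Fw mul1r mulrC /gamma_p.
  by rewrite -[p^-1 - 1]opprB powRN -powR_inv1 ?(ltW th_gt0)// -powRrM mulN1r powRN.
Qed.

End upper_estimate.

(** * Hoelder's inequality for finite sums *)

Section finite_hoelder.
Variables (R : realType) (p : R).
Hypothesis p1 : 1 < p.
Local Notation th := (1 - p^-1).

(** After division by the two factors on the right, Young's inequality applies termwise; if a factor
    is 0, all terms vanish. *)
Lemma sum_hoelder (I : finType) (c n : I -> R) :
  (forall i, 0 <= c i) -> (forall i, 0 <= n i) ->
  \sum_i c i * n i `^ th <= (\sum_i c i `^ p) `^ p^-1 * (\sum_i n i) `^ th.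
Proof.
move=> c0 n0; have p0 : 0 < p by exact: lt_trans p1.
have /andP[th0 th1] := conj_exp_itv p1.
set C := \sum_i c i `^ p; set N := \sum_i n i.
have C0 : 0 <= C by apply: sumr_ge0 => i _; exact: powR_ge0.
have N0 : 0 <= N by exact: sumr_ge0.
have RHS0 : 0 <= C `^ p^-1 * N `^ th by rewrite mulr_ge0 ?powR_ge0.
have [CE|CN] := eqVneq C 0.
  rewrite big1// => i _; have /eqP := CE; rewrite psumr_eq0; last first.
    by move=> k _; exact: powR_ge0.
  move=> /allP/(_ i (mem_index_enum _))/eqP/powR_eq0_eq0 ->.
  by rewrite mul0r.
have [NE|NN] := eqVneq N 0.
  rewrite big1// => i _; have /eqP := NE; rewrite psumr_eq0//.
  move=> /allP/(_ i (mem_index_enum _))/eqP ->.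
  by rewrite powR0 ?mulr0// gt_eqF.
have {CN}C0 : 0 < C by rewrite lt_neqAle eq_sym CN.
have {NN}N0 : 0 < N by rewrite lt_neqAle eq_sym NN.
have Cp0 : 0 < C `^ p^-1 by rewrite powR_gt0.
have Nt0 : 0 < N `^ th by rewrite powR_gt0.
suff : \sum_i (c i / C `^ p^-1) * (n i `^ th / N `^ th) <= 1.
  rewrite -(ler_pM2r (mulr_gt0 Cp0 Nt0)) mul1r; apply: le_trans.
  rewrite mulr_suml; apply: ler_sum => i _; rewrite le_eqVlt; apply/orP; left.
  by apply/eqP; field; rewrite !gt_eqF.
have E1 : \sum_i (p^-1 * (c i `^ p / C) + th * (n i / N)) = 1.
  rewrite big_split/= -!mulr_sumr -!mulr_suml !mulfV ?gt_eqF// !mulr1.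
  by rewrite subrKC.
rewrite -[leRHS]E1; apply: ler_sum => i _.
have := @conjugate_powR R (c i / C `^ p^-1) (n i `^ th / N `^ th) p th^-1.
rewrite !divr_ge0 ?powR_ge0// invr_gt0 invrK => /(_ isT isT p0 th0 (subrKC _ _)).
move=> /le_trans; apply; rewrite mulrC [X in _ + X]mulrC lerD//.
  rewrite powRM ?invr_ge0 ?powR_ge0// -(powR_inv1 (ltW Cp0)) -powRrM mulN1r powRN.
  by rewrite -powRrM mulVf ?gt_eqF// powRr1// ltW.
rewrite powRM ?invr_ge0 ?powR_ge0// -(powR_inv1 (ltW Nt0)) -!powRrM mulfV ?gt_eqF//.
by rewrite powRr1// mulN1r mulrN mulfV ?gt_eqF// powR_inv1// ltW.
Qed.

End finite_hoelder.

(** * The finite-dimensional weak-L^p lattice *)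

Section weak_norm_theory.
Variables (R : realType) (p : R) (n : nat).
Implicit Types a b : 'I_n -> R.
Local Notation th := (1 - p^-1).

Lemma wpnorm_triangle a b : wpnorm p (fun i => a i + b i) <= wpnorm p a + wpnorm p b.
Proof.
apply/wpnorm_leP; first by rewrite addr_ge0 ?wpnorm_ge0.
move=> A; rewrite mulrDl.
apply: le_trans (lerD (wpnorm_sum_le _ _ _) (wpnorm_sum_le _ _ _)).
by rewrite -big_split/=; apply: ler_sum => i _; exact: ler_normD.
Qed.

Lemma wpnormZ (l : R) a : wpnorm p (fun i => l * a i) = `|l| * wpnorm p a.
Proof.
have H k b : wpnorm p (fun i => k * b i) <= `|k| * wpnorm p b.
  apply/wpnorm_leP; first by rewrite mulr_ge0 ?wpnorm_ge0.
  move=> A; under eq_bigr do rewrite normrM.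
  by rewrite -mulr_sumr -mulrA ler_wpM2l// wpnorm_sum_le.
apply/le_anti; rewrite H/=; have [->|l0] := eqVneq l 0.
  by rewrite normr0 mul0r wpnorm_ge0.
have nl0 : 0 < `|l| by rewrite normr_gt0.
rewrite -ler_pdivlMl// -normfV (le_trans _ (H _ _))// le_eqVlt.
by apply/orP; left; apply/eqP; congr wpnorm; apply/funext => i; rewrite mulKf.
Qed.

Lemma le_wpnorm a i : `|a i| <= wpnorm p a.
Proof.
by have := wpnorm_sum_le p a [set i]%SET; rewrite big_set1 cards1 powR1 mulr1.
Qed.

Lemma wpnorm_le_max a (e : R) : 0 <= e -> (forall i, `|a i| <= e) ->
  wpnorm p a <= e * wpnorm p (fun _ : 'I_n => 1).
Proof.
move=> e0 ae; apply/wpnorm_leP; first by rewrite mulr_ge0 ?wpnorm_ge0.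
move=> A; rewrite -mulrA.
apply: le_trans (ler_wpM2l e0 (wpnorm_sum_le _ _ _)).
by rewrite mulr_sumr; apply: ler_sum => i _; rewrite normr1 mulr1.
Qed.

Lemma wpnorm_mono a b : (forall i, `|a i| <= `|b i|) -> wpnorm p a <= wpnorm p b.
Proof.
move=> ab; apply/wpnorm_leP; first exact: wpnorm_ge0.
by move=> A; apply: le_trans (wpnorm_sum_le _ _ _); apply: ler_sum.
Qed.

End weak_norm_theory.

(* An alias of the row vectors, on which the library puts the sup norm. *)
Definition weak_lp (R : realType) (p : R) (n : nat) : Type := 'rV[R]_n.

Section weak_lp_normed.
Variables (R : realType) (p : R) (n : nat).
Local Notation W := (weak_lp p n).

HB.instance Definition _ := GRing.Lmodule.copy W 'rV[R]_n.

Definition weak_lp_coord (x : W) (i : 'I_n) : R := (x : 'rV[R]_n) ord0 i.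
Local Notation coord := weak_lp_coord.

Definition weak_lp_norm (x : W) : R := wpnorm p (coord x).

Lemma weak_lp_normD (x y : W) : weak_lp_norm (x + y) <= weak_lp_norm x + weak_lp_norm y.
Proof.
rewrite /weak_lp_norm; have -> : coord (x + y) = fun i => coord x i + coord y i.
  by apply/funext => i; rewrite /coord mxE.
exact: wpnorm_triangle.
Qed.

Lemma weak_lp_normZ (l : R) (x : W) : weak_lp_norm (l *: x) = `|l| * weak_lp_norm x.
Proof.
rewrite /weak_lp_norm; have -> : coord (l *: x) = fun i => l * coord x i.
  by apply/funext => i; rewrite /coord mxE.
exact: wpnormZ.
Qed.

Lemma weak_lp_norm_eq0 (x : W) : weak_lp_norm x = 0 -> x = 0.
Proof.
move=> x0; apply/rowP => i; rewrite mxE; apply/eqP; rewrite -normr_le0 -x0.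
exact: le_wpnorm.
Qed.

HB.instance Definition _ := Lmodule_isNormed.Build R W
  weak_lp_normD weak_lp_normZ weak_lp_norm_eq0.

(** Coordinates are bounded by the norm, hence Cauchy; the finitely many coordinate limits are
    approached simultaneously, and [wpnorm_le_max] gives convergence in norm. *)
Lemma weak_lp_complete (F : set_system W) : ProperFilter F -> cauchy F -> cvg F.
Proof.
move=> FF /cauchyP Fc.
have coordF i : cvg (coord ^~ i @ F)%classic.
  apply: cauchy_cvg; apply/cauchyP => e e0.
  have [x Fx] := Fc e e0; exists (coord x i).
  suff : F [set y | ball (coord x i) e (coord y i)]%classic by [].
  apply: filterS Fx => y; rewrite -ball_normE /ball/= /ball_/=; apply: le_lt_trans.
  have := @le_wpnorm R p n (coord (x - y)) i.
  by rewrite {1}/coord !mxE.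
pose l : W := \row_i lim (coord ^~ i @ F)%classic.
apply/cvg_ex; exists l; apply/cvgrPdist_le => e e0.
(* The added 1 makes [C] positive also for n = 0. *)
pose C := wpnorm p (fun _ : 'I_n => 1) + 1.
have C0 : 0 < C by rewrite ltr_wpDl ?wpnorm_ge0.
have : \forall x \near F, forall i, `|lim (coord ^~ i @ F)%classic - coord x i| <= e / C.
  apply: filter_forall => i; have /cvgrPdist_le := coordF i; apply.
  exact: divr_gt0.
apply: filterS => x Hx.
have H i : `|coord (l - x) i| <= e / C by rewrite /coord !mxE; exact: Hx.
apply: le_trans (wpnorm_le_max p _ H) _; first by rewrite divr_ge0// ltW.
by rewrite mulrAC ler_pdivrMr// ler_pM2l// lerDl.
Qed.

HB.instance Definition _ := Uniform_isComplete.Build W weak_lp_complete.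

End weak_lp_normed.

Section weak_lp_lattice.
Variables (R : realType) (p : R) (n : nat).
Local Notation W := (weak_lp p n).
Local Notation coord := (@weak_lp_coord R p n).

Definition weak_lp_le (x y : W) := forall i, coord x i <= coord y i.

Definition weak_lp_sup (x y : W) : W := \row_i Num.max (coord x i) (coord y i).

Lemma weak_lp_coordD (x y : W) i : coord (x + y) i = coord x i + coord y i.
Proof. by rewrite /weak_lp_coord mxE. Qed.

Lemma weak_lp_coordZ a (x : W) i : coord (a *: x) i = a * coord x i.
Proof. by rewrite /weak_lp_coord mxE. Qed.

Lemma weak_lp_coordN (x : W) i : coord (- x) i = - coord x i.
Proof. by rewrite /weak_lp_coord mxE. Qed.

Lemma weak_lp_coord0 i : coord 0 i = 0.
Proof. by rewrite /weak_lp_coord mxE. Qed.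

Lemma weak_lp_coord_sup (x y : W) i :
  coord (weak_lp_sup x y) i = Num.max (coord x i) (coord y i).
Proof. by rewrite /weak_lp_coord mxE. Qed.

Lemma weak_lp_coord_sum (I : finType) (x : I -> W) i :
  coord (\sum_k x k) i = \sum_k coord (x k) i.
Proof.
apply: (big_morph (fun y => coord y i)); last exact: weak_lp_coord0.
by move=> y z; exact: weak_lp_coordD.
Qed.

Lemma weak_lp_coord_abs (x : W) i : coord (bl_abs weak_lp_sup x) i = `|coord x i|.
Proof. by rewrite weak_lp_coord_sup weak_lp_coordN maxrN. Qed.

Lemma weak_lp_normE (x : W) : `|x| = wpnorm p (coord x).
Proof. by []. Qed.

Lemma weak_lp_banach_lattice : is_banach_lattice weak_lp_le weak_lp_sup.
Proof.
split; first by move=> x i.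
split; first by move=> x y xy yx; apply/rowP => i; apply/le_anti; rewrite xy yx.
split; first by move=> x y z xy yz i; exact: le_trans (yz i).
split; first by move=> x y z xy i; rewrite !weak_lp_coordD lerD2r.
split.
  by move=> a x a0 x0 i; have := x0 i; rewrite weak_lp_coordZ !weak_lp_coord0; exact: mulr_ge0.
split.
  move=> x y; split; first by move=> i; rewrite weak_lp_coord_sup le_max lexx.
  split; first by move=> i; rewrite weak_lp_coord_sup le_max lexx orbT.
  by move=> z xz yz i; rewrite weak_lp_coord_sup ge_max xz yz.
move=> x y xy; rewrite !weak_lp_normE; apply: wpnorm_mono => i.
by have := xy i; rewrite !weak_lp_coord_abs.
Qed.

(** Disjoint vectors have disjoint supports, so the sets [B k] cut from A have cardinals adding up
    to at most that of A; the weak norm of each [x k] bounds its sum over [B k], and Hoelder's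
    inequality combines these bounds. *)
Lemma weak_lp_upper_p_estimate : 1 < p -> upper_p_estimate p weak_lp_sup.
Proof.
move=> p1 m x dis.
have disj i k k' : k != k' -> coord (x k) i != 0 -> coord (x k') i = 0.
  move=> kk' xk; have /(congr1 (fun y => coord y i)) := dis _ _ kk'.
  rewrite weak_lp_coordN weak_lp_coord_sup !weak_lp_coordN !weak_lp_coord_abs.
  rewrite weak_lp_coord0; have : 0 < `|coord (x k) i| by rewrite normr_gt0.
  have := normr_ge0 (coord (x k') i).
  case: (leP (- `|coord (x k) i|)) => ? ? ? ?; last by exfalso; lra.
  by apply/normr0_eq0; lra.
rewrite weak_lp_normE; apply/wpnorm_leP; first exact: powR_ge0.
move=> A.
pose B k := [set i in A | coord (x k) i != 0]%SET.
have sumB k : \sum_(i in A) `|coord (x k) i| = \sum_(i in B k) `|coord (x k) i|.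
  rewrite [LHS](bigID (fun i => coord (x k) i != 0))/= [X in _ + X]big1 ?addr0.
    by apply: eq_bigl => i; rewrite inE.
  by move=> i /andP[_]; rewrite negbK => /eqP ->; rewrite normr0.
apply: (@le_trans _ _ (\sum_k `|x k| * #|B k|%:R `^ (1 - p^-1))).
  apply: (@le_trans _ _ (\sum_(i in A) \sum_k `|coord (x k) i|)).
    by apply: ler_sum => i _; rewrite weak_lp_coord_sum; exact: ler_norm_sum.
  rewrite exchange_big/=; apply: ler_sum => k _; rewrite sumB.
  exact: wpnorm_sum_le.
apply: le_trans (sum_hoelder p1 _ _) _ => //.
rewrite ler_wpM2l ?powR_ge0// ge0_ler_powR ?nnegrE//.
- by case/andP: (conj_exp_itv p1) => /ltW.
- exact: sumr_ge0.
have -> : \sum_k #|B k|%:R = \sum_(i in A) \sum_k (coord (x k) i != 0)%:R :> R.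
  rewrite exchange_big/=; apply: eq_bigr => k _.
  rewrite -sumr_const big_mkcond [RHS]big_mkcond/=; apply: eq_bigr => i _.
  by rewrite inE; case: (i \in A); case: (_ != 0).
rewrite -sumr_const; apply: ler_sum => i _.
have [k xk|x0] := pickP (fun k => coord (x k) i != 0); last first.
  by rewrite big1// => k _; rewrite x0.
rewrite (bigD1 k)//= xk big1 ?addr0// => k' k'k.
by rewrite (disj i k k') ?eqxx// eq_sym.
Qed.

End weak_lp_lattice.

Lemma rho_pinf_le_Cpinf (R : realType) (E : normedModType R) (p : R) (f : fvl_expr R E) :
  1 < p -> (rho_pinf p f <= rho_Cpinf p f)%E.
Proof.
move=> p1; apply: ge_ereal_sup => _ [n [xs [xsb [xs1 ->]]]].
pose T x : weak_lp p n := \row_i xs i x.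
have TE x i : weak_lp_coord (T x) i = xs i x by rewrite /weak_lp_coord mxE.
have coordT x : weak_lp_coord (T x) = fun i => xs i x by apply/funext => i.
apply: ereal_sup_ubound.
exists (weak_lp p n : completeNormedModType R), (@weak_lp_le R p n),
  (@weak_lp_sup R p n), T.
split; first exact: weak_lp_banach_lattice.
split; first exact: weak_lp_upper_p_estimate.
split.
  have Tl a u v : T (a *: u + v) = a *: T u + T v.
    by apply/rowP => i; rewrite !mxE (xsb i).1.
  split=> //; apply: le_norm_of_unit_ball.
    move=> a x; rewrite -normrZ; congr `|_|.
    by apply/rowP => i; rewrite !mxE (islinearZ _ _ (xsb i).1).
  by move=> x x1; rewrite weak_lp_normE coordT; exact: xs1.
(* The lattice operations are coordinatewise, so coordinates commute with the evaluation of f. *)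
rewrite weak_lp_normE; congr (wpnorm p _)%:E; apply/funext => i.
elim: f => [x|f IHf g IHg|a f IHf|f IHf g IHg] /=.
- by rewrite TE.
- by rewrite weak_lp_coordD -IHf -IHg.
- by rewrite weak_lp_coordZ -IHf.
- by rewrite weak_lp_coord_sup -IHf -IHg.
Qed.

(** * Measurable partitions by signs and levels *)

Section sign_partition.
Context (R : realType) (d : measure_display) (Omega : measurableType d).

(** The map c labels the cells; each function of [vs] cuts every cell into the points where it is
    positive and the rest. *)
Lemma sign_partition (vs : seq (Omega -> R)) :
  (forall v, v \in vs -> measurable_fun setT v) ->
  exists (I : finType) (c : Omega -> I),
    (forall i, measurable [set t | c t = i]%classic) /\
    (forall v i, v \in vs -> (forall t, c t = i -> v t <= 0) \/
                             (forall t, c t = i -> 0 <= v t)).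
Proof.
elim: vs => [_|v vs IH mvs].
  exists unit, (fun=> tt); split=> // -[].
  by rewrite [X in measurable X](_ : _ = setT)//; apply/seteqP.
have [|I [c [mc Hc]]] := IH; first by move=> w wvs; apply: mvs; rewrite inE wvs orbT.
have mv : measurable_fun setT v by apply: mvs; rewrite inE eqxx.
have mpos : measurable [set t | 0 < v t]%classic.
  rewrite [X in measurable X](_ : _ = setT `&` v @^-1` [set` (`]0, +oo[%R : interval R)])%classic.
    by apply: mv => //; exact: measurable_itv.
  by apply/seteqP; split=> t /=; rewrite in_itv/= andbT; [|case].
exists (I * bool)%type, (fun t => (c t, 0 < v t)); split.
  move=> [i b]; rewrite [X in measurable X](_ : _ = [set t | c t = i] `&`
      (if b then [set t | 0 < v t] else ~` [set t | 0 < v t]))%classic.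
    by apply: measurableI => //; case: b => //; exact: measurableC.
  apply/seteqP; split=> t /=; first by case=> -> <-; split=> //; case: ifP => [//|/= ->].
  by case=> -> ; case: b => [->//|/negP/negbTE ->].
move=> w [i b]; rewrite inE => /predU1P[->|wvs].
  case: b; [right|left] => t [_]; first by move/ltW.
  by move/negbT; rewrite -leNgt.
by have [H|H] := Hc w i wvs; [left|right] => t [ci _]; exact: H.
Qed.

End sign_partition.

(** Pointwise counterpart of [level_approx]: if the least k with y <= l k e on P is positive, the
    previous level satisfies the other alternative on all of P. *)
Lemma level_approx_pointwise (R : realType) (U : Type) (P : set U) (y e : U -> R)
    (eta : R) (N : nat) :
  (forall t, P t -> `|y t| <= e t) -> 0 < eta -> 2 <= N%:R * eta ->
  (forall k, (k <= N)%N -> (forall t, P t -> y t - (k%:R * eta - 1) * e t <= 0) \/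
                           (forall t, P t -> 0 <= y t - (k%:R * eta - 1) * e t)) ->
  exists lam : R, forall t, P t -> `|y t - lam * e t| <= eta * e t.
Proof.
move=> ye eta0 Neta H; pose l (k : nat) := k%:R * eta - 1.
have e0 t : P t -> 0 <= e t by move=> /ye; exact: le_trans.
have y1 t : P t -> - e t <= y t by move=> /ye; rewrite ler_norml => /andP[].
have y2 t : P t -> y t <= e t by move=> /ye; rewrite ler_norml => /andP[].
have exk : exists k, (k <= N)%N && `[< forall t, P t -> y t - l k * e t <= 0 >].
  exists N; rewrite leqnn/=; apply/asboolP => t Pt.
  have l1 : 0 <= l N - 1 by rewrite /l; lra.
  by have := mulr_ge0 l1 (e0 t Pt); have := y2 t Pt; lra.
case: (ex_minnP exk) => -[|k] /andP[kN /asboolP Hk] kmin.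
  exists (-1) => t Pt; have := Hk t Pt; rewrite /l mul0r add0r.
  have := y1 t Pt; have := mulr_ge0 (ltW eta0) (e0 t Pt).
  by rewrite ler_norml => ? ? ?; apply/andP; split; lra.
have [Hk'|Hk'] := H k (ltnW kN).
  have := kmin k; rewrite (ltnW kN) => /(_ (asboolT Hk')); by rewrite ltnn.
exists (l k.+1) => t Pt; have := Hk t Pt; have := Hk' t Pt.
rewrite /l -natr1 ler_norml => ? ?; apply/andP; split; last lra.
by have := mulr_ge0 (ltW eta0) (e0 t Pt); lra.
Qed.

(** * Upper bound for operators into weak-L^p spaces *)

Section weak_Lp_bound.
Context (R : realType) (E : normedModType R) (p : R) (d : measure_display)
  (Omega : measurableType d) (mu : {measure set Omega -> \bar R}).
Variables (T : E -> Omega -> R) (f : fvl_expr R E) (r : R).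
Hypothesis p1 : 1 < p.
Hypothesis mT : forall x, measurable_fun setT (T x).
Hypothesis lT : forall (a : R) (u v : E),
  {ae mu, forall t, T (a *: u + v) t = a * T u t + T v t}.
Hypothesis cT : forall x, (wLnorm p mu (T x) <= `|x|%:E)%E.
Hypothesis rho_le : (rho_pinf p f <= r%:E)%E.
Variable A : set Omega.
Hypothesis mA : measurable A.
Hypothesis Aoo : (mu A < +oo)%E.
Local Notation th := (1 - p^-1).

Let th_gt0 : 0 < th. Proof. by case/andP: (conj_exp_itv p1). Qed.

Let mTB x (B : set Omega) : measurable_fun B (T x).
Proof. exact: measurable_funTS. Qed.

Let mnTB x (B : set Omega) : measurable_fun B (fun t => (`|T x t| : R)%:E).
Proof. by apply/measurable_EFinP; exact: measurableT_comp. Qed.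

Lemma sub_lty (B : set Omega) : measurable B -> (B `<=` A)%classic -> (mu B < +oo)%E.
Proof. by move=> mB BA; apply: le_lt_trans Aoo; apply: le_measure; rewrite ?inE. Qed.

Lemma weak_int_le x (B : set Omega) : measurable B -> (B `<=` A)%classic ->
  (\int[mu]_(t in B) `|T x t|%:E <= (fine (mu B) `^ th * `|x|)%:E)%E.
Proof.
move=> mB BA; have [B0|B0] := eqVneq (mu B) 0%E.
  by rewrite null_set_integral// lee_fin mulr_ge0 ?powR_ge0.
have Boo := sub_lty mB BA.
have Bgt0 : (0 < mu B)%E by rewrite lt0e B0 measure_ge0.
have fB : 0 < fine (mu B) by apply: fine_gt0; rewrite Bgt0.
have := cT x; rewrite EFinM -lee_pdivrMl ?powR_gt0//; apply: le_trans.
apply: ereal_sup_ubound; right; exists B; split=> //; split=> //; split=> //.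
by rewrite -powRN opprB.
Qed.

Lemma T_integrable x : mu.-integrable A (EFin \o T x).
Proof.
apply/integrableP; split; first exact/measurable_EFinP.
rewrite (eq_integral (fun t => `|T x t|%:E)); last by move=> t _; rewrite abse_EFin.
by apply: le_lt_trans (weak_int_le x mA (@subset_refl _ _)) _; rewrite ltry.
Qed.

Let e t := \sum_(x <- fvl_atoms f) `|T x t|.
Let h t := fvl_at f (fun x => T x t).

Lemma envelope_ge0 t : 0 <= e t.
Proof. exact: sumr_ge0. Qed.

Lemma le_envelope x t : x \in fvl_atoms f -> `|T x t| <= e t.
Proof.
rewrite /e; elim: (fvl_atoms f) => // y s IH; rewrite inE big_cons => /predU1P[->|/IH xs].
  by rewrite lerDl sumr_ge0.
by rewrite (le_trans xs)// lerDr.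
Qed.

Lemma measurable_envelope : measurable_fun setT e.
Proof. by apply: measurable_sum => x; exact: measurableT_comp. Qed.

Lemma integrable_envelope : mu.-integrable A (EFin \o e).
Proof.
rewrite (_ : EFin \o e = (fun t => \sum_(x <- fvl_atoms f) `|T x t|%:E)%E); last first.
  by apply/funext => t /=; rewrite /e sumEFin.
apply: integrable_sum => // x _; exact: integrable_norm (T_integrable x).
Qed.

Lemma measurable_fvl_at : measurable_fun setT h.
Proof.
rewrite /h /fvl_at; elim: f => //= [g Hg k Hk|a g Hg|g Hg k Hk].
- exact: measurable_funD.
- exact: measurable_funM.
- exact: measurable_maxr.
Qed.

Lemma fvl_at_le_envelope t : `|h t| <= fvl_lip f * e t.
Proof.
(* Zero is written as a multiple by 0, so that homogeneity evaluates f there. *)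
have := @fvl_at_lip R E f (fun x => T x t) (fun x => 0 * T x t) (e t).
rewrite fvl_atZ// mul0r subr0; apply => x xf.
by rewrite mul0r subr0 le_envelope.
Qed.

Lemma integrable_fvl_at : mu.-integrable A (EFin \o h).
Proof.
apply: (le_integrable mA) (integrableZl mA (fvl_lip f) integrable_envelope).
  by apply/measurable_EFinP; apply: measurable_funTS; exact: measurable_fvl_at.
move=> t _ /=; rewrite lee_fin (le_trans (fvl_at_le_envelope t))//.
by rewrite ger0_norm// mulr_ge0 ?fvl_lip_ge0 ?envelope_ge0.
Qed.

Lemma integrable_cst1 : mu.-integrable A (EFin \o cst (1 : R)).
Proof.
apply/integrableP; split; first exact/measurable_EFinP.
rewrite (eq_integral (cst 1%E)); last by move=> t _ /=; rewrite normr1.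
by rewrite integral_cst// mul1e.
Qed.

Section cells.
Variables (I : finType) (c : Omega -> I).
Hypothesis mc : forall i, measurable [set t | c t = i]%classic.

Let cell (S : {set I}) := (A `&` [set t | c t \in S])%classic.

Let cellE (S : {set I}) :
  cell S = \big[setU/set0]_(i <- enum S) (A `&` [set t | c t = i])%classic.
Proof.
rewrite -bigcup_seq; apply/seteqP; split=> t /=.
  by case=> At cS; exists (c t) => //=; rewrite mem_enum.
by case=> i /=; rewrite mem_enum => iS [At ci]; split=> //=; rewrite ci.
Qed.

Lemma measurable_cell S : measurable (cell S).
Proof. by rewrite cellE; apply: bigsetU_measurable => i _; exact: measurableI. Qed.

Lemma Rintegral_cells (S : {set I}) (g : Omega -> R) :
  mu.-integrable A (EFin \o g) -> (forall t, 0 <= g t) ->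
  \int[mu]_(t in cell S) g t = \sum_(i in S) \int[mu]_(t in cell [set i]%SET) g t.
Proof.
move=> ig g0.
have icell S' : mu.-integrable (cell S') (EFin \o g).
  apply: (integrableS mA) ig => //; first exact: measurable_cell.
  by move=> t [].
have cell1 i : cell [set i]%SET = (A `&` [set t | c t = i])%classic.
  apply/seteqP; split=> t /= [At]; first by move/set1P.
  by move=> ct; split=> //=; rewrite ct; exact/set1P.
apply: EFin_inj; rewrite -sumEFin /Rintegral.
rewrite fineK; last by apply: integrable_fin_num (icell _); exact: measurable_cell.
under [RHS]eq_bigr do rewrite fineK ?(integrable_fin_num (measurable_cell _))//.
under [RHS]eq_bigr do rewrite cell1.
rewrite cellE ge0_integral_bigsetU//=.
- by rewrite big_enum.
- by move=> i; exact: measurableI.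
- exact: enum_uniq.
- by move=> i j _ _ [t [[_ <-] [_ <-]]].
- by rewrite -cellE; exact: measurable_int (icell S).
- by move=> t _; rewrite lee_fin.
Qed.

End cells.

(** Counterpart of [posfun_fvl_eval_le] with integration over B as the functional: both sides are
    compared with the integral of e times the absolute value of [fvl_at f lam]. *)
Lemma Rintegral_fvl_le (B : set Omega) (lam : E -> R) (eta : R) :
  measurable B -> (B `<=` A)%classic ->
  (forall x, x \in fvl_atoms f -> forall t, B t -> `|T x t - lam x * e t| <= eta * e t) ->
  \int[mu]_(t in B) `|h t| <=
    `|fvl_at f (fun x => \int[mu]_(t in B) T x t)| +
    2 * (fvl_lip f * (eta * \int[mu]_(t in B) e t)).
Proof.
move=> mB BA H.
have iS (g : Omega -> R) : mu.-integrable A (EFin \o g) -> mu.-integrable B (EFin \o g).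
  exact: integrableS.
have ie := iS _ integrable_envelope.
have iZ k : mu.-integrable B (EFin \o (fun t => k * e t)).
  by have := integrableZl mB k ie.
set Ie := \int[mu]_(t in B) e t.
have Ie0 : 0 <= Ie by apply: Rintegral_ge0 => t _; exact: envelope_ge0.
pose K := `|fvl_at f lam| + fvl_lip f * eta.
have h1 : \int[mu]_(t in B) `|h t| <= K * Ie.
  rewrite -RintegralZl//; apply: le_Rintegral => //.
    exact: integrable_norm (iS _ integrable_fvl_at).
  move=> t Bt.
  have := @fvl_at_lip R E f (fun x => T x t) (fun x => e t * lam x) (eta * e t).
  rewrite fvl_atZ ?envelope_ge0// -/(h t) => /(_ _)/wrap[].
    by move=> x xf; rewrite [e t * _]mulrC; exact: H.
  move=> Hh; rewrite -[h t](subrK (e t * fvl_at f lam)).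
  apply: le_trans (ler_normD _ _) _.
  by rewrite normrM (ger0_norm (envelope_ge0 t)) /K; lra.
have h2 : `|fvl_at f (fun x => \int[mu]_(t in B) T x t) - Ie * fvl_at f lam| <=
    fvl_lip f * (eta * Ie).
  rewrite -fvl_atZ//; apply: fvl_at_lip => x xf.
  have iT := iS _ (T_integrable x).
  rewrite mulrC -RintegralZl// -RintegralB//.
  have iB : mu.-integrable B (EFin \o (fun t => T x t - lam x * e t)).
    by have := integrableB mB iT (iZ (lam x)).
  apply: le_trans (le_normr_Rintegral mB iB) _.
  rewrite -RintegralZl//; apply: le_Rintegral => //; first exact: (integrable_norm iB).
  by move=> t Bt; exact: H.
have h3 : Ie * `|fvl_at f lam| <=
    `|fvl_at f (fun x => \int[mu]_(t in B) T x t)| + fvl_lip f * (eta * Ie).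
  rewrite -{1}(ger0_norm Ie0) -normrM -lerBlDl; apply: le_trans h2.
  by rewrite distrC; exact: lerB_dist.
by move: h1 h3; rewrite /K; lra.
Qed.

(** Linearity of T holds only outside a null set depending on a, u and v; integration removes it. *)
Lemma Rintegral_linear (B : set Omega) (a : R) (u v : E) :
  measurable B -> (B `<=` A)%classic ->
  \int[mu]_(t in B) T (a *: u + v) t =
  a * \int[mu]_(t in B) T u t + \int[mu]_(t in B) T v t.
Proof.
move=> mB BA.
have iT x : mu.-integrable B (EFin \o T x) by exact: integrableS (T_integrable x).
rewrite -RintegralZl// -RintegralD//; last by have := integrableZl mB a (iT u).
rewrite /Rintegral; congr fine; apply: ae_eq_integral => //.
- exact/measurable_EFinP.
- apply/measurable_EFinP; apply: measurable_funD => //; exact: measurable_funM.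
- by apply: filterS (lT a u v) => t -> _.
Qed.

Lemma Rintegral_norm_fvl_le : \int[mu]_(t in A) `|h t| <= r * fine (mu A) `^ th.
Proof.
pose C := 2 * fvl_lip f * \int[mu]_(t in A) e t.
have e0 := envelope_ge0.
have C0 : 0 <= C.
  by rewrite !mulr_ge0 ?fvl_lip_ge0//; apply: Rintegral_ge0.
suff step eta : 0 < eta ->
    \int[mu]_(t in A) `|h t| <= r * fine (mu A) `^ th + C * eta.
  apply/ler_addgt0Pr => eps eps0.
  have C1 : 0 < C + 1 by rewrite ltr_wpDl.
  have := step (eps / (C + 1)); rewrite divr_gt0// => /(_ isT) /le_trans; apply.
  by rewrite lerD2l mulrCA ger_pMr// ler_pdivrMr// mul1r lerDl.
move=> eta0; pose N := (Num.truncn (2 / eta)).+1.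
have Neta : 2 <= N%:R * eta.
  rewrite -ler_pdivrMr// ltW//.
  by have /andP[] := truncn_itv (divr_ge0 (ler0n R 2) (ltW eta0)).
pose vs := [seq (fun t => T x t - (k%:R * eta - 1) * e t)
  | x <- fvl_atoms f, k <- iota 0 N.+1].
have [|I [c [mc Hc]]] := @sign_partition R d Omega vs.
  move=> _ /allpairsP[[x k] [_ _ ->]]; apply: measurable_funB => //.
  by apply: measurable_funM => //; exact: measurable_envelope.
pose cell (S : {set I}) := (A `&` [set t | c t \in S])%classic.
have mcell S : measurable (cell S) by exact: measurable_cell.
have cellA S : (cell S `<=` A)%classic by move=> t [].
have sum_cells (S : {set I}) (g : Omega -> R) : mu.-integrable A (EFin \o g) ->
    (forall t, 0 <= g t) -> \int[mu]_(t in cell S) g t =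
    \sum_(i in S) \int[mu]_(t in cell [set i]%SET) g t by exact: Rintegral_cells.
have cellT : cell [set: I]%SET = A.
  by apply/seteqP; split=> [t []//|t At]; split=> //=; rewrite finset.in_setT.
have ih := integrable_norm integrable_fvl_at.
rewrite -{1}cellT sum_cells//.
have cell_le i : \int[mu]_(t in cell [set i]%SET) `|h t| <=
    `|fvl_at f (fun x => \int[mu]_(t in cell [set i]%SET) T x t)| +
    2 * (fvl_lip f * (eta * \int[mu]_(t in cell [set i]%SET) e t)).
  have lamP x : exists lam : R, x \in fvl_atoms f -> forall t,
      cell [set i]%SET t -> `|T x t - lam * e t| <= eta * e t.
    have [xf|] := boolP (x \in fvl_atoms f); last by exists 0.
    have [||lam Hlam] := @level_approx_pointwise R Omega (cell [set i]%SET) (T x) e eta N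
        _ eta0 Neta.
    - by move=> t _; exact: le_envelope.
    - move=> k kN; have [|H|H] := Hc (fun t => T x t - (k%:R * eta - 1) * e t) i.
      + by apply/allpairsP; exists (x, k); split=> //; rewrite mem_iota add0n ltnS.
      + by left=> t [_ /set1P]; exact: H.
      + by right=> t [_ /set1P]; exact: H.
    - by exists lam.
  have [lam Hlam] := choice lamP.
  exact: Rintegral_fvl_le (mcell _) (cellA _) Hlam.
apply: (@le_trans _ _ (\sum_(i in [set: I]%SET)
    (`|fvl_at f (fun x => \int[mu]_(t in cell [set i]%SET) T x t)| +
     2 * (fvl_lip f * (eta * \int[mu]_(t in cell [set i]%SET) e t))))).
  by apply: ler_sum => i _; exact: cell_le.
rewrite big_split/=; apply: lerD; last first.
  rewrite -!mulr_sumr -sum_cells//; last exact: integrable_envelope.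
  by rewrite cellT /C le_eqVlt; apply/orP; left; apply/eqP; ring.
have mcellE (S : {set I}) : \sum_(i in S) fine (mu (cell [set i]%SET)) = fine (mu (cell S)).
  have := sum_cells S _ integrable_cst1 (fun=> ler01).
  rewrite Rintegral_cst// mul1r => ->.
  by apply: eq_bigr => i _; rewrite Rintegral_cst// mul1r.
have bound := sum_fvl_le_weight p1 rho_le (m := fun i => fine (mu (cell [set i]%SET)))
  (psi := fun i x => \int[mu]_(t in cell [set i]%SET) T x t).
rewrite (eq_bigl predT); last by move=> i; rewrite finset.in_setT.
have sumT : \sum_i fine (mu (cell [set i]%SET)) = fine (mu A).
  rewrite -[in RHS]cellT -mcellE; apply: eq_bigl => i; by rewrite finset.in_setT.
apply: (le_trans (bound _ _ _)).
- by move=> i; rewrite fine_ge0.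
- by move=> i a u v; exact: Rintegral_linear.
(* Admissibility: the integrals of the absolute value of [T x] over the cells in S add up to the one
   over their union, which the weak norm bounds. *)
- move=> x x1 S; rewrite mcellE.
  apply: (@le_trans _ _ (\int[mu]_(t in cell S) `|T x t|)).
    rewrite sum_cells//; last exact: integrable_norm (T_integrable x).
    apply: ler_sum => i _; apply: le_normr_Rintegral => //.
    exact: integrableS (T_integrable x).
  have := weak_int_le x (mcell S) (cellA S).
  rewrite -[X in (X <= _)%E]fineK; last first.
    apply: integrable_fin_num => //.
    exact: integrableS (integrable_norm (T_integrable x)).
  by rewrite lee_fin => /le_trans; apply; rewrite ler_piMr// powR_ge0.
- by rewrite sumT.
Qed.

End weak_Lp_bound.

Lemma rho_Xpinf_le (R : realType) (E : normedModType R) (p : R) (f : fvl_expr R E) (r : R) :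
  1 < p -> (rho_pinf p f <= r%:E)%E -> (rho_Xpinf p f <= r%:E)%E.
Proof.
move=> p1 rho_le; apply: ge_ereal_sup => z.
case=> disp; case=> Omega; case=> mu; case=> T; case=> _; case=> mT; case=> lT.
case=> cT {z}->.
apply: ge_ereal_sup => _ [-> | [A [mA [A0 [Aoo ->]]]]].
  by rewrite lee_fin (rho_pinf_ge0 rho_le).
have fA : 0 < fine (mu A) by apply: fine_gt0; rewrite A0.
have -> : p^-1 - 1 = - (1 - p^-1) by rewrite opprB.
rewrite powRN lee_pdivrMl ?powR_gt0// -EFinM.
have := Rintegral_norm_fvl_le p1 mT lT cT rho_le mA Aoo.
rewrite -lee_fin mulrC; apply: le_trans.
rewrite /Rintegral fineK//; apply: integrable_fin_num => //.
exact: integrable_norm (integrable_fvl_at f mT cT mA Aoo).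
Qed.

(** * Finite counting measures and the lower bound *)

Section finite_counting.
Variables (R : realType) (p : R) (n : nat).

(** The counting measure of the numbers below n, placed on [nat], where all sets are measurable. *)
Definition ord_counting : {measure set nat -> \bar R} :=
  msum (fun k => \d_k : {measure set nat -> \bar R}) n.

Let trace (A : set nat) := [set i : 'I_n | `[< A i >]]%SET.

Lemma ord_countingE (A : set nat) : ord_counting A = #|trace A|%:R%:E.
Proof.
rewrite /ord_counting/= /msum -sumr_const -sumEFin [RHS]big_mkcond/=.
apply: eq_bigr => i _; rewrite diracE finset.in_set.
have [Ai|Ai] := pselect (A i); first by rewrite (asboolT Ai) mem_set.
by rewrite (asboolF Ai) memNset.
Qed.

Lemma measurable_fun_nat (d : measure_display) (T : measurableType d) (A : set nat)
  (g : nat -> T) : measurable_fun A g.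
Proof. by []. Qed.

Lemma integral_ord_counting (A : set nat) (g : nat -> R) :
  (\int[ord_counting]_(t in A) `|g t|%:E = (\sum_(i in trace A) `|g i|)%:E)%E.
Proof.
rewrite ge0_integral_measure_sum//.
rewrite -sumEFin [RHS]big_mkcond/=; apply: eq_bigr => i _.
rewrite integral_dirac// diracE finset.in_set.
have [Ai|Ai] := pselect (A i); first by rewrite (asboolT Ai) mem_set// mul1e.
by rewrite (asboolF Ai) memNset// mul0e.
Qed.

(** Measure and integral depend only on the trace of a set on the numbers below n, and positive
    measure means nonempty trace. *)
Lemma wLnorm_ord_counting (g : nat -> R) :
  wLnorm p ord_counting g = (wpnorm p (fun i : 'I_n => g i))%:E.
Proof.
apply/le_anti; apply/andP; split.
  apply: ge_ereal_sup => _ [-> | [A [_ [A0 [_ ->]]]]].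
    by rewrite lee_fin wpnorm_ge0.
  rewrite integral_ord_counting ord_countingE/= -EFinM lee_fin.
  apply: (le_bigmax_cond 0 (fun A : {set 'I_n} =>
    #|A|%:R `^ (p^-1 - 1) * \sum_(i in A) `|g i|)).
  by move: A0; rewrite ord_countingE lte_fin ltr0n card_gt0.
have : (0 <= wLnorm p ord_counting g)%E by apply: ereal_sup_ubound; left.
have wL (S : {set 'I_n}) : S != finset.set0 ->
    ((#|S|%:R `^ (p^-1 - 1) * \sum_(i in S) `|g i|)%:E <= wLnorm p ord_counting g)%E.
  move=> S0; apply: ereal_sup_ubound; right.
  pose A := [set val i | i in [set` S]]%classic.
  have trA : trace A = S.
    apply/setP => i; rewrite finset.in_set; apply/asboolP/idP => [[j /= jS /val_inj <-]//|iS].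
    by exists i.
  exists A; split=> //; rewrite integral_ord_counting ord_countingE trA.
  by rewrite lte_fin ltr0n card_gt0 ltry/= EFinM.
move: (wLnorm p ord_counting g) wL => [s| |] wL // s0; last by rewrite leey.
by rewrite lee_fin; apply: bigmax_le => // S S0; rewrite -lee_fin; exact: wL.
Qed.

Lemma sigma_finite_ord_counting : sigma_finite setT ord_counting.
Proof.
exists (fun=> setT); first by rewrite bigcup_const//; exists 0.
by move=> _; split=> //; rewrite ord_countingE ltry.
Qed.

End finite_counting.

Lemma rho_pinf_le_Xpinf (R : realType) (E : normedModType R) (p : R) (f : fvl_expr R E) :
  (rho_pinf p f <= rho_Xpinf p f)%E.
Proof.
apply: ge_ereal_sup => _ [n [xs [xsb [xs1 ->]]]].
(* The value 0 is chosen outside the numbers below n, a null set. *)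
pose T x (k : nat) : R := if insub k is Some i then xs i x else 0.
have TE x (i : 'I_n) : T x i = xs i x by rewrite /T valK.
have fE : (fun i : 'I_n => fvl_at f (xs i)) = (fun i : 'I_n => fvl_at f (fun x => T x i)).
  by apply/funext => i; congr fvl_at; apply/funext => x; rewrite TE.
rewrite fE -(@wLnorm_ord_counting R p n (fun t => fvl_at f (fun x => T x t))).
apply: ereal_sup_ubound; exists default_measure_display, (nat : measurableType default_measure_display),
  (ord_counting R n), T.
split; first exact: sigma_finite_ord_counting.
split; first by move=> x; exact: measurable_fun_nat.
split.
  move=> a u v; apply: aeW => t; rewrite /T; case: insubP => [i _ _|_].
    exact: (xsb i).1.
  by rewrite mulr0 addr0.
split=> // x; rewrite wLnorm_ord_counting lee_fin.
have -> : (fun i : 'I_n => T x i) = (fun i => xs i x) by apply/funext => i.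
apply: (@le_norm_of_unit_ball _ _ (fun x => wpnorm p (fun i => xs i x))) => //.
move=> a y; rewrite -wpnormZ; congr wpnorm; apply/funext => i.
exact: islinearZ (xsb i).1.
Qed.

Theorem theorem3p5 (R : realType) (E : completeNormedModType R) (p : R) :
  1 < p ->
  forall f : fvl_expr R E,
    rho_Xpinf p f = rho_pinf p f /\
    (rho_pinf p f <= rho_Cpinf p f)%E /\
    (rho_Cpinf p f <= (gamma_p p)%:E * rho_pinf p f)%E.
Proof.
move=> p1 f; have gamma0 : 0 < gamma_p p.
  by apply: powR_gt0; case/andP: (conj_exp_itv p1).
(* Otherwise [rho_pinf_ge0] with r = -1 would give 0 <= -1. *)
have rhoNy : rho_pinf p f != -oo%E.
  apply/negP => /eqP rhoE; have := @rho_pinf_ge0 R p E f (-1).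
  by rewrite rhoE leNye => /(_ isT); lra.
split; last split; last 1 first.
(* An infinite supremum stays infinite after multiplication by the positive [gamma_p p]. *)
- case rhoE : (rho_pinf p f) rhoNy => [s| |]// _; last first.
    by rewrite gt0_muley ?lte_fin// leey.
  apply: ge_ereal_sup => _ [Y [le [sup [T [BL [UP [cT ->]]]]]]].
  by rewrite -EFinM lee_fin; apply: (norm_fvl_eval_le p1 BL UP cT); rewrite rhoE.
- apply/le_anti; rewrite rho_pinf_le_Xpinf andbT.
  case rhoE : (rho_pinf p f) rhoNy => [s| |]// _; last by rewrite leey.
  by apply: rho_Xpinf_le => //; rewrite rhoE.
- exact: rho_pinf_le_Cpinf.
Qed.
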